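(* Let $0<\rho<1$. Then there is a set $E$ consisting of at most two primes such that for every prime $p\notin E$, for $\mu_{\rho}$-almost every $\omega\in\Omega=\{0,1\}^{\mathbb{N}}$, the dynamical zeta function $$\zeta_{\alpha_{\omega}}(z)=\exp\sum_{n=1}^{\infty}|F_n(\alpha_{\omega})|\,\frac{z^n}{n}$$ of the automorphism $\alpha_{\omega}:X_{\omega}\to X_{\omega}$ is not an algebraic function (that is, it is not algebraic over the field $\mathbb{C}(z)$ of rational functions).
   Context: Let $p$ be a prime and $K=\mathbb{F}_p(t)$. The places of $K$ are the infinite place together with the finite places, which are in one-to-one correspondence with the monic irreducible polynomials $v\in\mathbb{F}_p[t]$; for a finite place $v$, $|f|_{v}=p^{-\mathrm{ord}_v(f)\deg(v)}$ for $f\in K\setminus\{0\}$ (and $|0|_v=0$), where $\mathrm{ord}_v(f)$ is the exponent of $v$ in the factorization of $f$. For each $p$, fix an (arbitrary) enumeration $v_{-1},v_0,v_1,v_2,\dots$ of the set of all places of $K$, each listed exactly once, with $v_{-1}$ the infinite place and $v_0$ the place corresponding to the irreducible polynomial $t$; thus $v_1,v_2,\dots$ enumerates the places corresponding to the monic irreducible polynomials other than $t$. Let $\Omega=\{0,1\}^{\mathbb{N}}$, with points $\omega=(\omega(k))_{k\ge1}$, and let $\mu_{\rho}=(\rho,1-\rho)^{\mathbb{N}}$ be the infinite product measure, under which the coordinates $\omega(k)$ are independent with $\omega(k)=0$ with probability $\rho$ and $\omega(k)=1$ with probability $1-\rho$. Each $\omega\in\Omega$ defines a ring $$R_{\omega}=\{f\in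 K: |f|_{v_k}\le 1\text{ for all }k\ge1\text{ such that }\omega(k)=0\}.$$ (No condition is imposed at the infinite place or at the place $t$, so $t$ is a unit in $R_\omega$.) $X_{\omega}$ is the compact abelian group that is the Pontryagin dual of the discrete additive group of $R_{\omega}$, and $\alpha_{\omega}:X_{\omega}\to X_{\omega}$ is the continuous automorphism dual to the automorphism $f\mapsto tf$ of the additive group of $R_{\omega}$. For $n\ge1$, $F_n(\alpha_{\omega})=\{x\in X_{\omega}:\alpha_{\omega}^n(x)=x\}$ is the (finite) set of points of period $n$ under $\alpha_\omega$, and $|F_n(\alpha_\omega)|$ is its cardinality; one has $|F_n(\alpha_\omega)|\le p^n$, so the series defining $\zeta_{\alpha_\omega}(z)$ converges for $|z|<1/p$. *)

(* Defs.v *)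
From HB Require Import structures.
From mathcomp Require Import all_boot all_order all_algebra all_field.
From mathcomp Require Import generic_quotient finmap complex ring.
From mathcomp Require Import all_classical all_reals all_analysis.
Set Implicit Arguments. Unset Strict Implicit. Unset Printing Implicit Defensive.
Import Order.TTheory GRing.Theory Num.Theory.
Import numFieldNormedType.Exports.
Local Open Scope classical_set_scope.
Local Open Scope ring_scope.
Local Open Scope quotient_scope.
Local Notation "x %:F" := (FracField.tofrac x).

Section Places.
Variable p : nat.

(* The primality of [p] is assumed where these definitions are used; the fields
   'F_p and {fraction {poly 'F_p}} make sense for every [p]. *)
Definition ratfun := {fraction {poly 'F_p}}.

Definition ratfun_t : ratfun := ('X : {poly 'F_p})%:F.

Definition finite_place := {q : {poly 'F_p} | (q \is monic) && irreducibleb q}.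

(* [e k] is the place $v_k$, for $k \ge 0$. The infinite place $v_{-1}$ is left
   out of the type, so that an enumeration $v_{-1}, v_0, v_1, \dots$ of all the
   places with $v_{-1} = \infty$ is the same thing as an enumeration
   $v_0, v_1, \dots$ of the finite ones. *)
Definition place_enumeration (e : nat -> finite_place) : Prop :=
  bijective e /\ val (e 0) = 'X.

(* The exponent of [q] in [a]; the bound [size a] on the exponents is no
   restriction for [a != 0] and [q] nonconstant. *)
Definition ord_poly (q a : {poly 'F_p}) : nat :=
  \max_(n < size a | q ^+ n %| a) n.

Definition num (f : ratfun) : {poly 'F_p} := (frac (repr f)).1.
Definition den (f : ratfun) : {poly 'F_p} := (frac (repr f)).2.

Definition ord_place (v : finite_place) (f : ratfun) : int :=
  (ord_poly (val v) (num f))%:Z - (ord_poly (val v) (den f))%:Z.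

Definition abs_place (v : finite_place) (f : ratfun) : rat :=
  if f == 0 then 0
  else p%:R ^ (- (ord_place v f * (size (val v)).-1%:Z)).

Lemma place_irr (v : finite_place) : irreducible_poly (val v).
Proof. by case: v => q /= /andP[_ /irreducibleP]. Qed.

Lemma ord_polyP (v : finite_place) (a : {poly 'F_p}) n :
  a != 0 -> (val v ^+ n %| a) = (n <= ord_poly (val v) a)%N.
Proof.
move=> a0; have [sq _] := place_irr v; have q0 := irredp_neq0 (place_irr v).
set q := val v in sq q0 *; apply/idP/idP => [dv|le].
  have lt : (n < size a)%N.
    apply: leq_trans (dvdp_leq a0 dv).
    have : (0 < size (q ^+ n))%N by rewrite size_poly_gt0 expf_neq0.
    move: (size_exp q n); case: size => // k /= -> _; rewrite ltnS.
    by rewrite leq_pmull // -ltnS prednK // ltnW.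
  exact: (@bigop.bigmax_sup _ (Ordinal lt) _ _ (fun i => nat_of_ord i)).
apply: dvdp_trans (dvdp_exp2l q le) _; rewrite /ord_poly.
elim/big_ind: _ => [|m k dm dk|//]; first by rewrite expr0 dvd1p.
by case: (leqP m k).
Qed.

Lemma den_neq0 (f : ratfun) : den f != 0.
Proof. exact: denom_ratioP. Qed.

Lemma ratfun_numden (f : ratfun) : f * (den f)%:F = (num f)%:F.
Proof.
rewrite /num /den; set x := repr f; have -> : f = \pi_(ratfun) x by rewrite reprK.
unlock FracField.tofrac; rewrite -[LHS]FracField.pi_mul; apply/eqmodP.
rewrite /= FracField.equivfE /FracField.mulf.
by rewrite !numden_Ratio ?(oner_neq0, mulf_neq0, denom_ratioP, mulr1) // mulrC.
Qed.

Lemma num_eq0 (f : ratfun) : (num f == 0) = (f == 0).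
Proof.
by rewrite -tofrac_eq0 -ratfun_numden mulf_eq0 tofrac_eq0 (negPf (den_neq0 f)) orbF.
Qed.

Lemma abs_place_le1E (v : finite_place) (f : ratfun) : (1 < p)%N -> f != 0 ->
  (abs_place v f <= 1) =
  (ord_poly (val v) (den f) <= ord_poly (val v) (num f))%N.
Proof.
move=> p1 f0; rewrite /abs_place (negPf f0).
have sz : (0 : int) < (size (val v)).-1%:Z.
  by have [s1 _] := place_irr v; rewrite ltz_nat -subn1 subn_gt0.
have p1r : (1 : rat) < p%:R by rewrite ltr1n.
rewrite -[X in _ <= X](expr0z (p%:R : rat)) ler_eXz2l //.
by rewrite oppr_le0 pmulr_lge0 // /ord_place subr_ge0 lez_nat.
Qed.

Lemma abs_place_le1P (v : finite_place) (f : ratfun) : (1 < p)%N ->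
  abs_place v f <= 1 <->
  exists a b : {poly 'F_p}, f * b%:F = a%:F /\ ~~ (val v %| b).
Proof.
move=> p1; have [f0|f0] := eqVneq f 0.
  split=> [_|_]; last by rewrite /abs_place f0 eqxx.
  exists 0, 1; rewrite f0 mul0r tofrac0; split=> //.
  have [s1 _] := place_irr v.
  by rewrite dvdp1; apply/negP => /eqP s0; rewrite s0 in s1.
have n0 : num f != 0 by rewrite num_eq0.
have d0 := den_neq0 f; have fE := ratfun_numden f.
have q0 := irredp_neq0 (place_irr v).
rewrite abs_place_le1E //; split=> [le|[a [b [fb nb]]]].
  have := ord_polyP v (ord_poly (val v) (den f)) n0; rewrite le => /dvdpP[a na].
  have := ord_polyP v (ord_poly (val v) (den f)) d0; rewrite leqnn => /dvdpP[b db].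
  exists a, b; split.
    have qF : (val v ^+ ord_poly (val v) (den f))%:F != 0 :> ratfun.
      by rewrite tofrac_eq0 expf_neq0.
    by apply: (mulIf qF); rewrite -mulrA -!tofracM -db -na.
  apply/negP => /dvdpP[c bc].
  have := ord_polyP v (ord_poly (val v) (den f)).+1 d0.
  by rewrite ltnn => /negP; apply; rewrite {2}db bc exprS -mulrA dvdp_mull.
rewrite -ord_polyP //.
have nbad : num f * b = a * den f.
  by apply/eqP; rewrite -tofrac_eq !tofracM -fb -fE mulrAC.
rewrite -(@Gauss_dvdpl _ _ b) ?nbad; first by rewrite dvdp_mull // ord_polyP.
by rewrite coprimep_expl // irreducible_poly_coprime //; exact: place_irr.
Qed.

End Places.

Section RingOmega.
Variables (p : nat) (v : nat -> finite_place p) (omega : nat -> bool).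

(* Points of $\Omega$ are indexed from 0: [omega k] is $\omega(k+1)$. *)
Definition in_ring_omega : {pred ratfun p} :=
  fun f => `[< forall k, omega k = false -> abs_place (v k.+1) f <= 1 >].

Lemma in_ring_omega_small f : (p <= 1)%N -> f \in in_ring_omega.
Proof.
move=> p1; apply/asboolP => k _; rewrite /abs_place; case: eqP => // _.
have [->|->] : (p%:R = 0 :> rat) \/ (p%:R = 1 :> rat).
- by move: p1; case: (p) => [|[|]] //; [left|right].
- by rewrite exp0rz; case: eqP.
- by rewrite exp1rz.
Qed.

Lemma in_ring_omegaP f : (1 < p)%N -> reflect
  (forall k, omega k = false ->
    exists a b : {poly 'F_p}, f * b%:F = a%:F /\ ~~ (val (v k.+1) %| b))
  (f \in in_ring_omega).
Proof.
move=> p1.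
apply: (iffP (asboolP (forall k, omega k = false -> abs_place (v k.+1) f <= 1))) => H k wk; have := H k wk;
  by move/abs_place_le1P => /(_ p1).
Qed.

Lemma ring_omega_subring : subring_closed in_ring_omega.
Proof.
have [p1|p1] := leqP p 1.
  by split=> [|f g _ _|f g _ _]; exact: in_ring_omega_small.
have irr := fun k => irreducible_poly_coprime _ (place_irr (v k)).
split=> [|f g /(in_ring_omegaP _ p1) fP /(in_ring_omegaP _ p1) gP
  |f g /(in_ring_omegaP _ p1) fP /(in_ring_omegaP _ p1) gP];
  apply/in_ring_omegaP => // k wk.
- exists 1, 1; rewrite mul1r tofrac1; split=> //.
  by rewrite -irr coprimep1.
- have [a [b [fb nb]]] := fP _ wk; have [c [d [gd nd]]] := gP _ wk.
  exists (a * d - c * b), (b * d); split.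
    by rewrite tofracB !tofracM -fb -gd mulrBl mulrA; congr (_ - _); ring.
  by rewrite -irr coprimepMr !irr nb nd.
- have [a [b [fb nb]]] := fP _ wk; have [c [d [gd nd]]] := gP _ wk.
  exists (a * c), (b * d); split; first by rewrite !tofracM -fb -gd; ring.
  by rewrite -irr coprimepMr !irr nb nd.
Qed.

HB.instance Definition _ :=
  GRing.isSubringClosed.Build (ratfun p) in_ring_omega ring_omega_subring.

Record ring_omega := RingOmega {
  ring_omega_val : ratfun p;
  _ : ring_omega_val \in in_ring_omega }.

HB.instance Definition _ := [isSub for ring_omega_val].
HB.instance Definition _ := [Choice of ring_omega by <:].
HB.instance Definition _ := [SubChoice_isSubComNzRing of ring_omega by <:].

Lemma in_ring_omega_t : ratfun_t p \in in_ring_omega.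
Proof.
have [p1|p1] := leqP p 1; first exact: in_ring_omega_small.
apply/in_ring_omegaP => // k _; exists 'X, 1; rewrite tofrac1 mulr1; split=> //.
by rewrite -(irreducible_poly_coprime _ (place_irr (v k.+1))) coprimep1.
Qed.

Definition ring_omega_t : ring_omega := RingOmega in_ring_omega_t.

End RingOmega.

Definition Cplx (R : realType) : numClosedFieldType := R[i].

Section Dual.
Variables (R : realType) (A : zmodType).

(* The points of the Pontryagin dual of [A]: as [A] is discrete, every
   homomorphism to the circle is continuous. *)
Record dual := Character {
  character_fun :> A -> Cplx R;
  character_circle : forall x, `|character_fun x| = 1;
  characterD : {morph character_fun : x y / x + y >-> x * y} }.

HB.instance Definition _ := gen_eqMixin dual.
HB.instance Definition _ := gen_choiceMixin dual.

End Dual.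

Section Alpha.
Variables (R : realType) (p : nat) (v : nat -> finite_place p).
Variable omega : nat -> bool.
Local Notation A := (ring_omega v omega).

Definition X_omega := dual R A.

Lemma alpha_circle (x : X_omega) (f : A) : `|x (ring_omega_t v omega * f)| = 1.
Proof. exact: character_circle. Qed.

Lemma alphaD (x : X_omega) :
  {morph (fun f : A => x (ring_omega_t v omega * f)) : f g / f + g >-> f * g}.
Proof. by move=> f g; rewrite mulrDr characterD. Qed.

Definition alpha_omega (x : X_omega) : X_omega :=
  Character (alpha_circle x) (alphaD x).

End Alpha.

Section Zeta.
Variable R : realType.
Local Notation C := (Cplx R).

Definition cexp (z : C) : C := limn (series (fun n => z ^+ n / n`!%:R)).

Variables (X : choiceType) (alpha : X -> X).

Definition periodic_points (n : nat) : set X := [set x | iter n alpha x = x].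

(* [fset_set] of an infinite set is empty; the sets counted here are finite. *)
Definition card_periodic (n : nat) : nat := #|` fset_set (periodic_points n)|.

(* The sum of the series over $n \ge 1$, reindexed from 0. *)
Definition dynamical_zeta (z : C) : C :=
  cexp (limn (series
    (fun n => (card_periodic n.+1)%:R * z ^+ n.+1 / n.+1%:R))).

End Zeta.

(* [f] is algebraic over C(z) on [D]: $P(z, f(z)) = 0$ on [D] for some nonzero
   $P(z, w)$ in C[z][w], the denominators of the coefficients in C(z) being
   cleared. *)
Definition algebraic_function_on (R : realType) (D : set (Cplx R))
    (f : Cplx R -> Cplx R) : Prop :=
  exists P : {poly {poly Cplx R}},
    P != 0 /\ forall z, D z -> P.[(f z)%:P].[z] = 0.

Definition coordinate_events : set (set (nat -> bool)) :=
  [set A | exists k b, A = [set omega | omega k = b]].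

Definition Omega := g_sigma_algebraType coordinate_events.

(* [mu] is the product measure $(\rho, 1-\rho)^{\mathbb N}$, [false] standing
   for 0 and [true] for 1; its values on these cylinders determine [mu]. *)
Definition is_product_measure (R : realType) (rho : R)
    (mu : probability Omega R) : Prop :=
  forall (J : seq nat) (s : nat -> bool), uniq J ->
    mu [set omega : Omega | forall k, k \in J -> omega k = s k] =
    (\prod_(k <- J) (if s k then 1 - rho else rho))%:E.

(* Main.v *)
(* The count |F_n| is p^(b n), where b n adds up deg(v) ord_v(t^n - 1) over the places v with
   omega(v) = 0: F_n is dual to R_omega/(t^n - 1), which is F_p[t] modulo the part of t^n - 1
   supported on those places.

   If zeta were algebraic, its logarithmic derivative would be algebraic, hence D-finite, so the
   |F_n| would satisfy a linear recurrence with polynomial coefficients and some length s. This is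
   contradicted by isolated peaks: indices n with |F_m| <= p^(-n/q) |F_n| whenever 0 < |m - n| <= s.

   Peaks almost surely exist for n = q^k, with q a large prime. The irreducible factors of
   t^(q^k) - 1 that do not divide t^(q^(k-1)) - 1 have degree at least q^(k-c), so there are at
   most q^c of them, and with probability bounded below they all survive; then b n >= (1 - 1/q) n.
   On the other hand b m has mean about rho m, which is well below (1 - 2/q) n, so Markov's
   inequality together with Harris' correlation inequality gives b m <= (1 - 2/q) n simultaneously
   for all m in the window, again with probability bounded below. All these bounds hold
   conditionally on any finite set of coordinates, provided k is large, so infinitely many trials
   succeed almost surely. The argument works for every prime p, so E is empty. *)
Require Import Defs.
From HB Require Import structures.
From mathcomp Require Import all_boot all_order all_algebra all_field cyclic.
From mathcomp Require Import generic_quotient finmap complex.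
From mathcomp Require Import all_classical all_reals all_analysis.
From mathcomp Require Import zify ring lra.
Set Implicit Arguments. Unset Strict Implicit. Unset Printing Implicit Defensive.
Import Order.TTheory GRing.Theory Num.Theory.
Import numFieldNormedType.Exports.

(** * Orders of [p] modulo prime powers *)

(** Successive trials share coordinates, and a revealed place that survives could have large
    multiplicity in t^m - 1 for m near q^k. That multiplicity is at most the p-part of m, so k is
    restricted to exponents with q^k = q modulo a high power of p: then m is within r of q modulo
    this power, its p-part is at most q + r, and the revealed places contribute a bounded amount
    while q^k grows. The two halves of a peak concern disjoint sets of places: where t has order
    exactly q^k, the place divides no t^m - 1 with m in the window, as q^k does not divide m. The
    margin in rho <= 1 - 4/q is spent as follows: bounded errors raise the mean of b m to at most (1
    - 3/q) n, and Markov against the threshold (1 - 2/q) n leaves probability at least 1/q. Since q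
    must exceed the recurrence length, which depends on the sample point, peaks are produced almost
    surely for all window sizes at once. The analytic half uses only real germs at 0 from the right,
    where zeta is the exponential of a real power series; no complex differentiation is needed. *)

Section LiftingTheExponent.
Variable q : nat.
Hypothesis q_pr : prime q.
Hypothesis q_odd : odd q.

Lemma geom_sum_eq y m : (y + 1) ^ m = y * (\sum_(i < m) (y + 1) ^ i) + 1.
Proof.
elim: m => [|m IH]; first by rewrite big_ord0 muln0.
rewrite big_ord_recr /= expnSr mulnDr muln1 [in RHS]mulnDr.
move: IH; set P := (y + 1) ^ m; set S := \sum_(_ < _) _ => IH.
by rewrite [P * y]mulnC; lia.
Qed.

Lemma expn_expand t i : exists w, (q * t + 1) ^ i = 1 + i * (q * t) + q * q * w.
Proof.
elim: i => [|i [w IH]]; first by exists 0; rewrite mul0n muln0.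
exists (w * (q * t + 1) + i * t * t).
by rewrite expnS IH mulSn; ring.
Qed.

Lemma geom_sum_expand t m : exists w,
  \sum_(i < m) (q * t + 1) ^ i = m + 'C(m, 2) * (q * t) + q * q * w.
Proof.
elim: m => [|m [w IH]]; first by exists 0; rewrite big_ord0 bin0n !mul0n muln0.
have [w' E] := expn_expand t m.
exists (w + w'); rewrite big_ord_recr /= IH E binS bin1 -[m.+1]addn1; ring.
Qed.

Lemma geom_sum_mod t m : \sum_(i < m) (q * t + 1) ^ i = m %[mod q].
Proof.
have [w ->] := geom_sum_expand t m.
have -> : m + 'C(m, 2) * (q * t) + q * q * w = ('C(m, 2) * t + q * w) * q + m by ring.
by rewrite modnMDl.
Qed.

(** Modulo q^2 the sum is q + 'C(q, 2) q t, and for odd q the binomial coefficient is itself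
    divisible by q, so the sum is q modulo q^2. *)
Lemma logn_geom_sum t : logn q (\sum_(i < q) (q * t + 1) ^ i) = 1.
Proof.
have [w ->] := geom_sum_expand t q.
rewrite bin2odd //.
have -> : q + q * q.-1./2 * (q * t) + q * q * w = q * (q * (q.-1./2 * t + w) + 1) by ring.
set X := q * (q.-1./2 * t + w); have nd : (q %| X + 1) = false.
  by rewrite dvdn_addr ?dvdn_mulr // dvdn1 gtn_eqF ?prime_gt1.
have X1 : 0 < X + 1 by rewrite addn1.
rewrite (lognM q (prime_gt0 q_pr) X1) (logn_prime q q_pr) eqxx.
by rewrite logn_coprime // prime_coprime // nd.
Qed.

(** Lifting the exponent: each factor q of m contributes a geometric sum of valuation 1, and a
    factor of m prime to q contributes a geometric sum that is a unit modulo q. *)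
Lemma logn_expn_sub1 t m : 0 < t -> 0 < m ->
  logn q ((q * t + 1) ^ m).-1 = logn q (q * t) + logn q m.
Proof.
have [n] := ubnP m; elim: n m t => // n IH m t mn t0 m0.
have q0 := prime_gt0 q_pr.
have [/dvdnP[m' mE]|qm] := boolP (q %| m); last first.
  rewrite geom_sum_eq addn1 /= lognM ?muln_gt0 ?q0 //; last first.
    by case: m m0 {mn qm} => // m _; rewrite big_ord_recl.
  have qS : ~~ (q %| \sum_(i < m) (q * t + 1) ^ i) by rewrite /dvdn geom_sum_mod.
  by apply/eqP; rewrite eqn_add2l !logn_coprime ?prime_coprime.
have m'0 : 0 < m' by move: m0; rewrite mE muln_gt0 => /andP[].
have [w zE] : exists w, (q * t + 1) ^ m' = q * w + 1.
  by exists (t * \sum_(i < m') (q * t + 1) ^ i); rewrite geom_sum_eq mulnA.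
have z1 : 1 < (q * t + 1) ^ m'.
  by apply: leq_ltn_trans m'0 (ltn_expl _ _); rewrite addn1 ltnS muln_gt0 q0.
have w0 : 0 < w by move: z1; rewrite zE addn1 ltnS muln_gt0 q0.
have := IH m' t _ t0 m'0; rewrite zE addn1 /= => IH'.
rewrite mE expnM zE geom_sum_eq addn1 /= lognM ?muln_gt0 ?q0 //; last first.
  by rewrite -(prednK q0) big_ord_recl.
rewrite logn_geom_sum IH'; last first.
  by rewrite -ltnS (leq_trans _ mn) // ltnS mE -[X in X < _]muln1 ltn_pmul2l // prime_gt1.
by rewrite (lognM q m'0 q0) (logn_prime q q_pr) eqxx addnA.
Qed.

(** Raising p to the power h = [totient q] makes it 1 modulo q, so that lifting the exponent
    applies; c is the q-valuation of p^h - 1. With e the degree of a place where t has order q^k,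
    this gives the lower bound on that degree. *)
Lemma pow_dvd_exponent p : 1 < p -> ~~ (q %| p) ->
  exists c, forall k e, 0 < e -> q ^ k %| (p ^ e).-1 -> q ^ (k - c) %| e.
Proof.
move=> p1 qp; have q1 := prime_gt1 q_pr.
have [h h0 hE] : exists2 h, 0 < h & p ^ h = 1 %[mod q].
  exists (totient q); first by rewrite totient_gt0 prime_gt0.
  by apply: Euler_exp_totient; rewrite coprime_sym prime_coprime.
have ph1 : 1 < p ^ h by exact: leq_ltn_trans h0 (ltn_expl _ p1).
have : q %| p ^ h - 1 by rewrite -eqn_mod_dvd; [apply/eqP|exact: ltnW].
rewrite subn1.
case/dvdnP => t tE; have phE : p ^ h = q * t + 1 by rewrite mulnC -tE addn1 prednK // ltnW.
have t0 : 0 < t by move: ph1; rewrite phE addn1 ltnS muln_gt0 => /andP[].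
exists (logn q (q * t)) => k e e0 dv.
have dv' : q ^ k %| (p ^ (h * e)).-1.
  rewrite mulnC expnM -[p ^ e]prednK ?expn_gt0 ?(ltnW p1) // -addn1.
  by rewrite geom_sum_eq addn1 /= dvdn_mulr.
have p0 : 0 < (p ^ (h * e)).-1.
  rewrite -ltnS prednK ?expn_gt0 ?(ltnW p1) //.
  by apply: leq_ltn_trans (ltn_expl _ p1); rewrite muln_gt0 h0.
move: dv'; rewrite pfactor_dvdn // expnM phE logn_expn_sub1 // => kle.
rewrite pfactor_dvdn // leq_subLR //.
Qed.

End LiftingTheExponent.

(* With [expn_mod_cycle], keeps the p-parts of the indices q^k + i and q^k - i bounded
   independently of k, so that t^(q^k + i) - 1 has factors of bounded multiplicity. *)
Lemma logn_shift_bound p q M n m i : prime p -> (i < q) ->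
  n = q %[mod p ^ M] -> q + i < p ^ M -> 0 < m ->
  m = n + i \/ n = m + i -> p ^ logn p m <= q + i.
Proof.
move=> p_pr iq nq qM m0 mi; set a := logn p m.
have p1 := prime_gt1 p_pr.
(* The congruence for n says nothing beyond p^M, so the valuation is first truncated at M. The bound
   obtained for p^b is below p^M, which shows that nothing was cut off. *)
pose b := minn a M.
have bm : p ^ b %| m by rewrite pfactor_dvdn // geq_minl.
have nqb : n = q %[mod p ^ b].
  have d : p ^ b %| p ^ M by rewrite dvdn_exp2l // geq_minr.
  by rewrite -(modn_dvdm _ d) nq modn_dvdm.
have ble : p ^ b <= q + i.
  case: mi => mE.
    apply: dvdn_leq; first by rewrite addn_gt0 (leq_ltn_trans _ iq).
    by rewrite /dvdn -modnDml -nqb modnDml -mE.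
  have : p ^ b %| q - i.
    rewrite -(eqn_mod_dvd _ (ltnW iq)) -nqb mE -modnDml (eqP bm) add0n //.
  move/dvdn_leq; rewrite subn_gt0 iq => /(_ isT) h; apply: leq_trans h _.
  by rewrite (leq_trans (leq_subr _ _)) // leq_addr.
have bM : b < M by rewrite -(ltn_exp2l _ _ p1) (leq_ltn_trans ble).
suff -> : a = b by [].
by move: bM; rewrite /b; case: (leqP a M) => // aM; rewrite ltnn.
Qed.

(** As q is a unit modulo p^M, every exponent that is 1 modulo [totient (p ^ M)] will do. *)
Lemma expn_mod_cycle p q M N : prime p -> prime q -> p != q ->
  exists2 k, N <= k & q ^ k = q %[mod p ^ M].
Proof.
move=> p_pr q_pr pq; exists (totient (p ^ M) * N).+1.
  by rewrite ltnW // ltnS leq_pmull // totient_gt0 expn_gt0 prime_gt0.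
have cop : coprime q (p ^ M).
  by rewrite coprime_sym coprimeXl // prime_coprime // dvdn_prime2.
rewrite expnS expnM -modnMmr -modnXm Euler_exp_totient // modnXm exp1n modnMmr muln1 //.
Qed.

Local Open Scope classical_set_scope.
Local Open Scope ring_scope.
Local Notation "x %:F" := (FracField.tofrac x).

(** * Power series near 0 on the right *)

Section PowerSeries.
Variable R : realType.
Implicit Types (e : nat -> R) (x C : R).

(** The exponent [n.+1] lets one parameter C >= 1 serve both as constant factor and as inverse
    radius, so that sums, scalings, shifts and derivatives only enlarge C. *)
Definition geom_le C e := forall n, `|e n| <= C ^+ n.+1.

Definition psum e x : R := limn (pseries e x).

Lemma is_cvg_pseries_norm C e x : 0 <= C -> geom_le C e -> C * `|x| < 1 ->
  cvgn (series (fun n => `|e n * x ^+ n|)).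
Proof.
move=> C0 eC Cx; apply: (@series_le_cvg _ _ (geometric C (C * `|x|))).
- by move=> n; apply: normr_ge0.
- by move=> n; rewrite /geometric /= mulr_ge0 ?exprn_ge0 ?mulr_ge0.
- move=> n; rewrite /geometric /= normrM normrX exprMn mulrA -exprS.
  by rewrite ler_wpM2r ?exprn_ge0.
- by apply: is_cvg_geometric_series; rewrite ger0_norm // mulr_ge0.
Qed.

Lemma is_cvg_pseries C e x : 0 <= C -> geom_le C e -> C * `|x| < 1 ->
  cvgn (pseries e x).
Proof.
by move=> C0 eC Cx; apply: normed_cvg; exact: is_cvg_pseries_norm eC Cx.
Qed.

Lemma geom_leW C D e : 0 <= C -> C <= D -> geom_le C e -> geom_le D e.
Proof.
move=> C0 CD eC n; apply: le_trans (eC n) _.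
by rewrite lerXn2r // nnegrE ?(le_trans C0).
Qed.

Lemma geom_le_natmul C e : 0 <= C -> geom_le C e ->
  geom_le (2 * C) (fun n => n%:R * e n).
Proof.
move=> C0 eC n; rewrite normrM exprMn ler_pM // ger0_norm //.
by rewrite -natrX ler_nat ltnW // (leq_trans (ltn_expl n (ltnSn 1))) // leq_exp2l.
Qed.

Lemma geom_le_shift C e : 1 <= C -> geom_le C e ->
  geom_le (C ^+ 2) (fun n => e n.+1).
Proof.
move=> C1 eC n; apply: le_trans (eC n.+1) _.
by rewrite -exprM ler_weXn2l // mul2n -addnn addnS ltnS leq_addr.
Qed.

Lemma geom_leD C e e' : 0 <= C -> geom_le C e -> geom_le C e' ->
  geom_le (2 * C) (fun n => e n + e' n).
Proof.
move=> C0 eC eC' n; rewrite exprMn.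
apply: (le_trans (ler_normD _ _)); apply: (le_trans (lerD (eC n) (eC' n))).
have X0 : 0 <= C ^+ n.+1 by rewrite exprn_ge0.
rewrite -mulr2n -[leLHS]mulr_natl ler_wpM2r // exprS ler_peMr //.
by rewrite exprn_ege1 // ler1n.
Qed.

Lemma psumS C e x : 0 <= C -> geom_le C e -> C * `|x| < 1 ->
  cvgn (pseries (fun n => e n.+1) x) ->
  psum e x = e 0%N + x * psum (fun n => e n.+1) x.
Proof.
move=> C0 eC Cx cS; rewrite /psum.
have cE := is_cvg_pseries C0 eC Cx.
have -> : limn (pseries e x) = limn (fun n => pseries e x n.+1).
  by apply/esym/cvg_lim => //; rewrite cvg_shiftS; exact: cE.
apply/cvg_lim => //.
have -> : (fun n => pseries e x n.+1) =
    (fun n => e 0%N + x * pseries (fun n => e n.+1) x n).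
  apply/funext => n; rewrite /pseries /series /= big_nat_recl //= expr0 mulr1.
  by congr (_ + _); rewrite mulr_sumr; apply: eq_bigr => i _; rewrite exprS; ring.
by apply: cvgD; [exact: cvg_cst|apply: cvgM; [exact: cvg_cst|exact: cS]].
Qed.

Lemma psum_bound C e x : 0 <= C -> geom_le C e -> C * `|x| <= 2^-1 ->
  `|psum e x| <= 2 * C.
Proof.
move=> C0 eC Cx; have Cx1 : C * `|x| < 1 by lra.
have cN := is_cvg_pseries_norm C0 eC Cx1.
apply: le_trans (lim_series_norm cN) _.
have Cx0 : 0 <= C * `|x| by rewrite mulr_ge0.
have gc : series (geometric C (C * `|x|)) @ \oo --> C / (1 - C * `|x|).
  by apply: cvg_geometric_series; rewrite ger0_norm.
have -> : 2 * C = C / 2^-1 by rewrite invrK mulrC.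
apply: (@le_trans _ _ (C / (1 - C * `|x|))).
  rewrite -(cvg_lim _ gc) //; apply: lim_series_le => //.
    by apply/cvg_ex; exists (C / (1 - C * `|x|)).
  move=> n; rewrite /geometric /= normrM normrX exprMn mulrA -exprS.
  by rewrite ler_wpM2r ?exprn_ge0.
by rewrite ler_wpM2l // lef_pV2 ?posrE; lra.
Qed.

Lemma near0_pos_small C : 0 < C -> \forall x \near (0:R)^'+, 0 < x /\ C * `|x| < 1.
Proof.
move=> C0; near=> x; have x0 : 0 < x by [].
split=> //; rewrite gtr0_norm // mulrC -ltr_pdivlMr // mul1r.
by near: x; apply: nbhs_right_lt; rewrite invr_gt0.
Unshelve. all: by end_near.
Qed.

Lemma psum_eq0_0 C e : 1 <= C -> geom_le C e ->
  (\forall x \near 0^'+, psum e x = 0) -> e 0%N = 0.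
Proof.
move=> C1 eC e0.
have C0 : 0 < C by rewrite (lt_le_trans _ C1).
have eC' := geom_le_shift C1 eC.
have C20 : 0 < C ^+ 2 by rewrite exprn_gt0.
apply/eqP; rewrite -normr_le0; apply/ler_addgt0Pr => d d0; rewrite add0r.
near (0:R)^'+ => x.
have [x0 x1] : 0 < x /\ C * `|x| < 1 by near: x; exact: near0_pos_small.
have [_ x2] : 0 < x /\ (2 * C ^+ 2) * `|x| < 1.
  by near: x; apply: near0_pos_small; rewrite mulr_gt0.
have [_ x3] : 0 < x /\ (2 * C ^+ 2 / d) * `|x| < 1.
  by near: x; apply: near0_pos_small; rewrite divr_gt0 ?mulr_gt0.
have x2' : C ^+ 2 * `|x| <= 2^-1 by lra.
have x2'' : C ^+ 2 * `|x| < 1 by lra.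
have E : psum e x = 0 by near: x.
move: E; rewrite (psumS (ltW C0) eC x1); last first.
  exact: is_cvg_pseries (ltW C20) eC' x2''.
move/eqP; rewrite addr_eq0 => /eqP ->; rewrite normrN normrM.
have B := psum_bound (ltW C20) eC' x2'.
apply: (@le_trans _ _ (`|x| * (2 * C ^+ 2))); first by rewrite ler_wpM2l.
by move: x3; rewrite mulrAC ltr_pdivrMr // mul1r mulrC => /ltW.
Unshelve. all: by end_near.
Qed.

(** Identity theorem with data on one side of 0 only. The constant coefficient is the limit at 0;
    once it vanishes, division by x > 0 shifts the series, at the cost of replacing C by C^2. *)
Lemma psum_eq0 C e : 1 <= C -> geom_le C e ->
  (\forall x \near 0^'+, psum e x = 0) -> forall n, e n = 0.
Proof.
move=> C1 eC + n; elim: n C e C1 eC => [|n IH] C e C1 eC e0.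
  exact: psum_eq0_0 C1 eC e0.
have C0 : 0 < C by rewrite (lt_le_trans _ C1).
have C20 : 0 < C ^+ 2 by rewrite exprn_gt0.
have eC' := geom_le_shift C1 eC.
have e00 := psum_eq0_0 C1 eC e0.
apply: (IH (C ^+ 2) (fun n => e n.+1)) => //; first by rewrite exprn_ege1.
near=> x.
have [x0 x1] : 0 < x /\ C * `|x| < 1 by near: x; exact: near0_pos_small.
have [_ x2] : 0 < x /\ C ^+ 2 * `|x| < 1 by near: x; exact: near0_pos_small.
have E : psum e x = 0 by near: x.
move: E; rewrite (psumS (ltW C0) eC x1); last first.
  exact: is_cvg_pseries (ltW C20) eC' x2.
by rewrite e00 add0r => /eqP; rewrite mulf_eq0 gt_eqF //= => /eqP.
Unshelve. all: by end_near.
Qed.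

Lemma geom_le_diffs C e : 1 <= C -> geom_le C e ->
  geom_le (4 * C ^+ 2) (pseries_diffs e).
Proof.
move=> C1 eC; have C0 : 0 <= C by rewrite (le_trans _ C1).
have -> : 4 * C ^+ 2 = (2 * C) ^+ 2 by ring.
by apply: geom_le_shift (geom_le_natmul C0 eC); lra.
Qed.

(** Termwise differentiation asks for convergence of the second formal derivative at a point K
    beyond |x|. Two uses of [geom_le_diffs] give the base 4 (4 C^2)^2 = 64 C^4, and K is the
    midpoint of |x| and its inverse. *)
Lemma is_derive_psum C e x : 1 <= C -> geom_le C e -> 64 * C ^+ 4 * `|x| < 1 ->
  is_derive x 1 (psum e) (psum (pseries_diffs e) x).
Proof.
move=> C1 eC Cx; have C0 : 0 <= C by rewrite (le_trans _ C1).
have C21 : 1 <= 4 * C ^+ 2 by nra.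
have C41 : 1 <= 64 * C ^+ 4.
  by have := exprn_ege1 4 C1; set y := C ^+ 4; lra.
have dC := geom_le_diffs C1 eC.
have ddC := geom_le_diffs C21 dC.
have C4E : 4 * (4 * C ^+ 2) ^+ 2 = 64 * C ^+ 4 by ring.
rewrite C4E in ddC.
have C2le : 4 * C ^+ 2 <= 64 * C ^+ 4 by rewrite -C4E; nra.
have Cle : C <= 64 * C ^+ 4 by apply: le_trans C2le; nra.
have C40 : 0 < 64 * C ^+ 4 by lra.
have xi : `|x| < (64 * C ^+ 4)^-1 by rewrite -[X in _ < X]mul1r ltr_pdivlMr // mulrC.
pose K := (`|x| + (64 * C ^+ 4)^-1) / 2.
have K0 : 0 <= K by rewrite /K divr_ge0 // addr_ge0 // invr_ge0 ltW.
have xK : `|x| < `|K| by rewrite (ger0_norm K0) /K; lra.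
have K1 : 64 * C ^+ 4 * `|K| < 1.
  rewrite ger0_norm // mulrC -ltr_pdivlMr // mul1r /K; lra.
have cv f : geom_le (64 * C ^+ 4) f -> cvgn (pseries f K).
  by move=> fC; apply: is_cvg_pseries fC K1; exact: ltW.
apply: pseries_snd_diffs xK; apply: cv => //.
- exact: geom_leW eC.
- by apply: geom_leW dC => //; lra.
Qed.

End PowerSeries.

Section PowerSeriesGerm.
Variable R : realType.
Implicit Types (e : nat -> R) (x C : R) (u : R -> R).

Definition germ_psum e u :=
  exists C, [/\ 1 <= C, geom_le C e & \forall x \near 0^'+, u x = psum e x].

Lemma germ_psum0 : germ_psum (fun=> 0) (fun=> 0).
Proof.
exists 1; split=> // [n|]; first by rewrite normr0 expr1n.
near=> x; rewrite /psum; apply/esym/cvg_lim => //.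
have -> : pseries (fun=> 0) x = cst 0.
  by apply/funext => n; rewrite /pseries /series /= big1 // => i _; rewrite mul0r.
exact: cvg_cst.
Unshelve. all: by end_near.
Qed.

Lemma germ_psumD e e' u u' : germ_psum e u -> germ_psum e' u' ->
  germ_psum (fun n => e n + e' n) (fun x => u x + u' x).
Proof.
move=> [C [C1 eC uE]] [D [D1 eD uE']].
have C0 : 0 <= C by lra. have D0 : 0 <= D by lra.
have eC' : geom_le (C + D) e by apply: geom_leW eC => //; lra.
have eD' : geom_le (C + D) e' by apply: geom_leW eD => //; lra.
have CD0 : 0 < C + D by lra.
exists (2 * (C + D)); split; [lra|exact: geom_leD (ltW CD0) eC' eD'|].
near=> x.
have [_ x1] : 0 < x /\ (C + D) * `|x| < 1 by near: x; exact: near0_pos_small.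
have -> : u x = psum e x by near: x.
have -> : u' x = psum e' x by near: x.
have c := is_cvg_pseries (ltW CD0) eC' x1.
have c' := is_cvg_pseries (ltW CD0) eD' x1.
apply/esym/cvg_lim => //.
have -> : pseries (fun n => e n + e' n) x = pseries e x \+ pseries e' x.
  apply/funext => n; rewrite /pseries /series /= -big_split /=.
  by apply: eq_bigr => i _; rewrite mulrDl.
exact: cvgD.
Unshelve. all: by end_near.
Qed.

Lemma germ_psumZ k e u : germ_psum e u ->
  germ_psum (fun n => k * e n) (fun x => k * u x).
Proof.
move=> [C [C1 eC uE]].
have C0 : 0 < C by lra.
have k1 : 1 <= 1 + `|k| by rewrite lerDl.
exists ((1 + `|k|) * C); split; first by nra.
  move=> n; rewrite normrM exprMn ler_pM //.
  apply: (@le_trans _ _ (1 + `|k|)); first by rewrite lerDr.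
  by rewrite exprS ler_peMr ?exprn_ege1 // (le_trans _ k1).
near=> x.
have [_ x1] : 0 < x /\ C * `|x| < 1 by near: x; exact: near0_pos_small.
have -> : u x = psum e x by near: x.
have c := is_cvg_pseries (ltW C0) eC x1.
apply/esym/cvg_lim => //.
have -> : pseries (fun n => k * e n) x = (fun n => k * pseries e x n).
  apply/funext => n; rewrite /pseries /series /= mulr_sumr.
  by apply: eq_bigr => i _; rewrite mulrA.
by apply: cvgM => //; exact: cvg_cst.
Unshelve. all: by end_near.
Qed.

Definition shift_up e n := if n is m.+1 then e m else 0.

Lemma germ_psumX e u : germ_psum e u ->
  germ_psum (shift_up e) (fun x => x * u x).
Proof.
move=> [C [C1 eC uE]].
have C0 : 0 < C by lra.
have sC : geom_le C (shift_up e).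
  case=> [|n] /=; first by rewrite normr0 exprn_ge0 // ltW.
  by rewrite (le_trans (eC n)) // ler_weXn2l.
exists C; split=> //; near=> x.
have [_ x1] : 0 < x /\ C * `|x| < 1 by near: x; exact: near0_pos_small.
have -> : u x = psum e x by near: x.
have cS := is_cvg_pseries (ltW C0) eC x1.
by rewrite (psumS (ltW C0) sC x1) /= ?add0r.
Unshelve. all: by end_near.
Qed.

Definition conv_poly (c : {poly R}) e n := \sum_(j < n.+1) c`_j * e (n - j)%N.

Lemma germ_psumM (c : {poly R}) e u : germ_psum e u ->
  germ_psum (conv_poly c e) (fun x => c.[x] * u x).
Proof.
move=> eu; elim/poly_ind: c => [|c k IH].
  have := germ_psum0; congr germ_psum; apply/funext => x.
    by rewrite /conv_poly big1 // => i _; rewrite coef0 mul0r.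
  by rewrite horner0 mul0r.
have := germ_psumD (germ_psumX IH) (germ_psumZ k eu).
congr germ_psum; apply/funext => x; last first.
  by rewrite hornerD hornerMX hornerC; ring.
rewrite /conv_poly; case: x => [|n] /=.
  by rewrite big_ord1 /= coefD coefMX coefC /= !add0r.
rewrite [RHS]big_ord_recl /= coefD coefMX coefC /= add0r subn0 addrC.
congr (_ + _); apply: eq_bigr => i _.
by rewrite coefD coefMX coefC /= addr0 subSS.
Qed.

Lemma germ_psum_sum (I : Type) (r : seq I) (e : I -> nat -> R) (u : I -> R -> R) :
  (forall i, germ_psum (e i) (u i)) ->
  germ_psum (fun n => \sum_(i <- r) e i n) (fun x => \sum_(i <- r) u i x).
Proof.
move=> eu; elim: r => [|i r IH].
  have := germ_psum0; congr germ_psum; apply/funext => x; by rewrite big_nil.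
have := germ_psumD (eu i) IH.
by congr germ_psum; apply/funext => x; rewrite big_cons.
Qed.

Lemma germ_psum_eq0 e u : germ_psum e u ->
  (\forall x \near 0^'+, u x = 0) -> forall n, e n = 0.
Proof.
move=> [C [C1 eC uE]] u0; apply: psum_eq0 C1 eC _.
near=> x; have <- : u x = psum e x by near: x.
by near: x.
Unshelve. all: by end_near.
Qed.

End PowerSeriesGerm.

(** * Algebraic functions have P-recursive logarithmic derivatives *)

Section LinearDependence.
Variable D : idomainType.
Local Open Scope quotient_scope.

(** A kernel vector exists over the fraction field; multiplying it by the product of all its
    denominators brings it back to [D]. *)
Lemma lin_dep_idomain m n (M : 'M[D]_(m, n)) : (n < m)%N ->
  exists2 c : 'rV[D]_m, c != 0 & c *m M = 0.
Proof.
move=> nm; pose MF := map_mx (@FracField.tofrac D) M.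
have : kermx MF != 0.
  rewrite kermx_eq0 /row_free; apply: contraTneq nm => rM.
  by rewrite -leqNgt -rM rank_leq_col.
case/rowV0Pn => u uK u0; have {uK}uM : u *m MF = 0 by apply/sub_kermxP.
pose den i := (frac (repr (u 0 i))).2; pose nume i := (frac (repr (u 0 i))).1.
have dE i : den i != 0 by rewrite denom_ratioP.
have uE i : u 0 i * (den i)%:F = (nume i)%:F.
  rewrite /nume /den; set x := repr _; have -> : u 0 i = \pi_({fraction D}) x by rewrite reprK.
  unlock FracField.tofrac; rewrite -[LHS]FracField.pi_mul; apply/eqmodP.
  rewrite /= FracField.equivfE /FracField.mulf.
  by rewrite !numden_Ratio ?(oner_neq0, mulf_neq0, denom_ratioP, mulr1) // mulrC.
exists (\row_i (nume i * \prod_(j | j != i) den j)).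
  have [i ui] : exists i, u 0 i != 0.
    apply/existsP; apply: contraNT u0 => /existsPn H; apply/eqP/rowP => i.
    by rewrite mxE; apply/eqP; have := H i; rewrite negbK.
  apply/eqP => /rowP /(_ i); rewrite !mxE => /eqP; apply/negP.
  rewrite mulf_neq0 //; last by apply/prodf_neq0 => j _.
  by rewrite -tofrac_eq0 -uE mulf_neq0 ?tofrac_eq0.
apply/rowP => k; rewrite !mxE; apply/eqP; rewrite -tofrac_eq0.
rewrite rmorph_sum /=; apply/eqP.
have /rowP/(_ k) := uM; rewrite !mxE => /(congr1 ( *%R (\prod_i den i)%:F)).
rewrite mulr0 mulr_sumr => E; rewrite -[RHS]E; apply: eq_bigr => i _.
rewrite !mxE. by rewrite !tofracM -uE [in RHS](bigD1 i) //= tofracM; ring.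
Qed.
End LinearDependence.

Section AlgebraicGerms.
Variable R : realType.
Implicit Types (A P Q : {poly {poly R}}) (x y : R) (u v f : R -> R).

Definition ev A y x : R := A.[y%:P].[x].

Lemma evD A P y x : ev (A + P) y x = ev A y x + ev P y x.
Proof. by rewrite /ev !hornerD. Qed.
Lemma evM A P y x : ev (A * P) y x = ev A y x * ev P y x.
Proof. by rewrite /ev !hornerM. Qed.
Lemma evC (c : {poly R}) y x : ev c%:P y x = c.[x].
Proof. by rewrite /ev hornerC. Qed.
Lemma evX y x : ev 'X y x = y.
Proof. by rewrite /ev hornerX hornerC. Qed.
Lemma evN A y x : ev (- A) y x = - ev A y x.
Proof. by rewrite /ev !hornerN. Qed.
Lemma evZ (c : {poly R}) A y x : ev (c *: A) y x = c.[x] * ev A y x.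
Proof. by rewrite -mul_polyC evM evC. Qed.
Lemma ev0 y x : ev 0 y x = 0.
Proof. by rewrite /ev !horner0. Qed.
Lemma ev_sum (I : Type) (r : seq I) (F : I -> {poly {poly R}}) y x :
  ev (\sum_(i <- r) F i) y x = \sum_(i <- r) ev (F i) y x.
Proof. by elim/big_rec2: _ => [|i a b _ <-]; rewrite ?ev0 ?evD. Qed.

Lemma is_derive_ev A f df x : is_derive x (1:R) f df ->
  is_derive x (1:R) (fun t => ev A (f t) t)
    (ev (map_poly (@deriv R) A) (f x) x + ev A^`() (f x) x * df).
Proof.
move=> fx; elim/poly_ind: A => [|A c IH].
  have -> : (fun t => ev 0 (f t) t) = cst 0 by apply/funext => t; rewrite ev0.
  by rewrite deriv0 raddf0 !ev0 mul0r addr0; exact: is_derive_cst.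
have -> : (fun t => ev (A * 'X + c%:P) (f t) t) =
    (fun t => ev A (f t) t) * f + horner c.
  by apply/funext => t; rewrite evD evM evC evX.
apply: is_derive_eq.
have -> : map_poly (@deriv R) (A * 'X + c%:P) =
    map_poly (@deriv R) A * 'X + (c^`())%:P.
  apply/polyP => i; rewrite coef_map /= !coefD !coefMX !coefC coef_map /=.
  by case: i => [|i] /=; rewrite ?add0r // !addr0.
rewrite derivD derivM derivX derivC addr0 mulr1 !evD !evM !evC !evX.
rewrite -![_ *: _]/(_ * _) /=.
set a := ev _ _ _; set b := ev _ _ _; set c' := ev _ _ _.
ring.
Qed.

(** Derivatives at x depend on a two-sided neighbourhood of x; this supplies one for each small x >
    0. *)
Lemma near_right_open (P : R -> Prop) : (\forall x \near (0:R)^'+, P x) ->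
  \forall x \near (0:R)^'+, \forall y \near x, P y.
Proof.
move=> /nbhs_ballP[e /= e0 H]; near=> x.
have xe : x \in `]0, e[ by rewrite in_itv /=; apply/andP; split; near: x;
  [exact: nbhs_right_gt|exact: nbhs_right_lt].
apply: filterS (near_in_itvoo xe) => y; rewrite in_itv /= => /andP[y0 ye].
by apply: H => //=; rewrite /ball /= sub0r normrN gtr0_norm.
Unshelve. all: by end_near.
Qed.

Lemma horner_neq0_near (r : {poly R}) : r != 0 ->
  \forall x \near (0:R)^'+, r.[x] != 0.
Proof.
move=> r0; have [m [s]] := multiplicity_XsubC r 0; rewrite r0 /= => s0 rE.
have sn : \forall x \near (0:R)^'+, s.[x] != 0.
  have : s.[x] @[x --> 0^'+] --> s.[0].
    by apply: cvg_at_right_filter; exact: continuous_horner.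
  by move/cvgr_neq0; apply.
near=> x; rewrite rE hornerM horner_exp hornerXsubC subr0 mulf_neq0 //.
  by near: x.
by rewrite expf_neq0 // gt_eqF.
Unshelve. all: by end_near.
Qed.

Lemma near_eq_derive_right u v u' v' :
  (\forall x \near (0:R)^'+, u x = v x) ->
  (\forall x \near (0:R)^'+, is_derive x (1:R) u (u' x)) ->
  (\forall x \near (0:R)^'+, is_derive x (1:R) v (v' x)) ->
  \forall x \near (0:R)^'+, u' x = v' x.
Proof.
move=> /near_right_open uv du dv; near=> x.
have ux : is_derive x (1:R) u (u' x) by near: x.
have vx : is_derive x (1:R) v (v' x) by near: x.
have E : \near x, u x = v x by near: x.
have vx' := near_eq_is_derive E ux.
by rewrite -(@derive_val _ _ _ _ _ _ _ vx') (@derive_val _ _ _ _ _ _ _ vx).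
Unshelve. all: by end_near.
Qed.

Section Rep.
Variable f : R -> R.

(* The germ of u at 0 on the right lies in R(x)[f], with the denominator r cleared. *)
Definition ratgerm u := exists r A, r != 0 /\
  \forall x \near (0:R)^'+, r.[x] * u x = ev A (f x) x.

Lemma ratgerm_near_eq u v : (\forall x \near (0:R)^'+, u x = v x) -> ratgerm u -> ratgerm v.
Proof.
move=> uv [r [A [r0 H]]]; exists r, A; split=> //; near=> x.
have <- : u x = v x by near: x.
by near: x.
Unshelve. all: by end_near.
Qed.

Lemma ratgerm_ev A : ratgerm (fun x => ev A (f x) x).
Proof.
by exists 1, A; rewrite oner_neq0; split=> //; near=> x; rewrite hornerC mul1r.
Unshelve. all: by end_near.
Qed.

Lemma ratgermD u v : ratgerm u -> ratgerm v -> ratgerm (fun x => u x + v x).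
Proof.
move=> [r [A [r0 uA]]] [s [B [s0 vB]]].
exists (r * s), (s%:P * A + r%:P * B); split; first by rewrite mulf_neq0.
near=> x; rewrite evD !evM !evC hornerM.
have <- : r.[x] * u x = ev A (f x) x by near: x.
have <- : s.[x] * v x = ev B (f x) x by near: x.
ring.
Unshelve. all: by end_near.
Qed.

Lemma ratgermM u v : ratgerm u -> ratgerm v -> ratgerm (fun x => u x * v x).
Proof.
move=> [r [A [r0 uA]]] [s [B [s0 vB]]].
exists (r * s), (A * B); split; first by rewrite mulf_neq0.
near=> x; rewrite !evM hornerM.
have <- : r.[x] * u x = ev A (f x) x by near: x.
have <- : s.[x] * v x = ev B (f x) x by near: x.
ring.
Unshelve. all: by end_near.
Qed.

Lemma ratgerm_divp (r : {poly R}) u : r != 0 -> ratgerm (fun x => r.[x] * u x) -> ratgerm u.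
Proof.
move=> r0 [s [A [s0 H]]]; exists (s * r), A; split; first by rewrite mulf_neq0.
near=> x; have <- : s.[x] * (r.[x] * u x) = ev A (f x) x by near: x.
by rewrite hornerM mulrA.
Unshelve. all: by end_near.
Qed.

Lemma ratgerm_horner (c : {poly R}) : ratgerm (horner c).
Proof.
have := ratgerm_ev c%:P; congr ratgerm; apply/funext => x; exact: evC.
Qed.

Lemma ratgermN u : ratgerm u -> ratgerm (fun x => - u x).
Proof.
move=> ru; have := ratgermM (ratgerm_horner (-1)) ru.
by congr ratgerm; apply/funext => x; rewrite hornerN hornerC mulN1r.
Qed.

Section Algebraic.
Variables (f' : R -> R) (P : {poly {poly R}}).
Hypothesis df : \forall x \near (0:R)^'+, is_derive x (1:R) f (f' x).
Hypothesis P0 : P != 0.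
Hypothesis evP : \forall x \near (0:R)^'+, ev P (f x) x = 0.

(** Here h plays gcd(p, p') and q plays p / h, up to nonzero constants. If w were not a root of q,
    its full multiplicity in p would sit in h and hence in p', where the multiplicity is one
    less. *)
Lemma root_div_gcd (p q h u : {poly R}) k l w : k != 0 -> l != 0 -> p != 0 ->
  q * h = k *: p -> l *: p^`() = u * h -> root p w -> root q w.
Proof.
move=> k0 l0 p0 qh uh pw; apply: contraT => qw.
have [m [s]] := multiplicity_XsubC p w; rewrite p0 /= => sw pE.
case: m pE => [|m] pE; first by move: pw sw; rewrite pE mulr1 => ->.
have : ('X - w%:P) ^+ m.+1 %| p^`().
  rewrite -(dvdpZr _ _ l0) uh dvdp_mull //.
  rewrite -(@Gauss_dvdpr _ _ q); last first.
    by rewrite coprimep_expl // coprimep_sym coprimep_XsubC.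
  by rewrite qh dvdpZr // pE dvdp_mull.
rewrite pE derivM deriv_exp derivXsubC mul1r dvdp_addr; last exact: dvdp_mull.
rewrite /= mulrnAr -mulrnAl exprS.
rewrite dvdp_mul2r ?expf_neq0 ?polyXsubC_eq0 // dvdp_XsubCl.
rewrite rootE hornerMn mulrn_eq0 /=.
by rewrite -rootE (negPf sw).
Qed.

Lemma ev_spec A y x : ev A y x = (map_poly (horner_eval x) A).[y].
Proof. by rewrite -[y in RHS](hornerC y x) horner_map. Qed.

(* Germs of functions may have zero divisors, so that P cannot be replaced by one of its factors
   arbitrarily; dividing by gcd(P, P') is allowed because it keeps all the roots at each x. *)
Lemma separable_annihilator : exists Q U V r,
  [/\ \forall x \near (0:R)^'+, ev Q (f x) x = 0, r != 0 &
   U * Q + V * Q^`() = r%:P].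
Proof.
pose h := gcdp P P^`(); pose q := P %/ h.
have qh := Pdiv.Idomain.divpK (dvdp_gcdl P P^`()).
have [[l u] /= l0 lu] := Pdiv.Idomain.dvdpP _ _ (dvdp_gcdr P P^`()).
have := make_separable P0; rewrite separable_poly.unlock.
move=> /Pdiv.Idomain.Bezout_coprimepP[[U V]] /= /Pdiv.Idomain.eqpP[[c d] /= /andP[c0 d0] E].
exists q, (c *: U), (c *: V), d; split=> //; last first.
  by rewrite -!scalerAl -scalerDr E -mul_polyC mulr1.
set k := lead_coef _ ^+ _ in qh; have k0 : k != 0 by exact: Pdiv.Idomain.lc_expn_scalp_neq0.
have lc0 : lead_coef P != 0 by rewrite lead_coef_eq0.
near=> x.
have lx : l.[x] != 0 by near: x; exact: horner_neq0_near.
have kx : k.[x] != 0 by near: x; exact: horner_neq0_near.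
have lcx : (lead_coef P).[x] != 0 by near: x; exact: horner_neq0_near.
have Px : ev P (f x) x = 0 by near: x.
rewrite ev_spec; apply/eqP; rewrite -/(root _ _).
pose sp := map_poly (horner_eval x).
apply: (@root_div_gcd (sp P) (sp q) (sp h) (sp u) _ _ _ kx lx).
- apply: contra lcx => /eqP /(congr1 (fun p : {poly R} => p`_(size P).-1)).
  rewrite coef0 coef_map /= => E0; apply/eqP; exact: E0.
- by rewrite -rmorphM /= qh /sp map_polyZ.
- by rewrite -rmorphM /= -lu /sp map_polyZ /= deriv_map.
- by rewrite /root -ev_spec Px.
Unshelve. all: by end_near.
Qed.

(** Differentiating Q(f, x) = 0 gives Q_x + Q_y f' = 0. Multiplication by V turns Q_y into r,
    because U Q vanishes along f; hence r f' = - V Q_x. *)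
Lemma ratgerm_derive_root : ratgerm f'.
Proof.
have [Q [U [V [r [evQ r0 UV]]]]] := separable_annihilator.
exists r, (- (V * map_poly (@deriv R) Q)); split=> //.
have dQ : \forall x \near (0:R)^'+, is_derive x (1:R) (fun t => ev Q (f t) t)
    (ev (map_poly (@deriv R) Q) (f x) x + ev Q^`() (f x) x * f' x).
  by apply: filterS df => x; exact: is_derive_ev.
have d0 : \forall x \near (0:R)^'+, is_derive x (1:R) (cst (0:R)) 0.
  by near=> x; exact: is_derive_cst.
have E := near_eq_derive_right evQ dQ d0.
near=> x; rewrite evN evM.
have Ex : ev (map_poly (@deriv R) Q) (f x) x + ev Q^`() (f x) x * f' x = 0.
  by near: x.
have Qx : ev Q (f x) x = 0 by near: x.
have := congr1 (fun A => ev A (f x) x) UV.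
rewrite /= evC evD !evM Qx mulr0 add0r => <-.
by move/eqP: Ex; rewrite addr_eq0 => /eqP ->; ring.
Unshelve. all: by end_near.
Qed.

Lemma ratgerm_derive u u' : (\forall x \near (0:R)^'+, is_derive x (1:R) u (u' x)) ->
  ratgerm u -> ratgerm u'.
Proof.
move=> du ru; have [r [A [r0 uA]]] := ru.
have dA : \forall x \near (0:R)^'+, is_derive x (1:R) (fun t => ev A (f t) t)
    (ev (map_poly (@deriv R) A) (f x) x + ev A^`() (f x) x * f' x).
  by apply: filterS df => x; exact: is_derive_ev.
have dru : \forall x \near (0:R)^'+, is_derive x (1:R) (horner r * u)
    (r.[x] * u' x + u x * r^`().[x]).
  by apply: filterS du => x ux; exact: is_deriveM.
have E := near_eq_derive_right uA dru dA.
apply: (ratgerm_divp r0).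
have R1 : ratgerm (fun x => ev (map_poly (@deriv R) A) (f x) x +
    ev A^`() (f x) x * f' x + - (u x * r^`().[x])).
  apply: ratgermD; last by apply/ratgermN/ratgermM => //; exact: ratgerm_horner.
  apply: ratgermD; first exact: ratgerm_ev.
  by apply: ratgermM; [exact: ratgerm_ev|exact: ratgerm_derive_root].
apply: ratgerm_near_eq R1; near=> x.
have <- : r.[x] * u' x + u x * r^`().[x] = ev (map_poly (@deriv R) A) (f x) x +
    ev A^`() (f x) x * f' x by near: x.
by rewrite addrK.
Unshelve. all: by end_near.
Qed.

(** After removing the powers of y from P, what remains is B y + Q(0) with Q(0) nonzero, and it
    still vanishes along f; so Q(0) / f = - B(f). *)
Lemma ratgerm_inv : (forall x, f x != 0) -> ratgerm (fun x => (f x)^-1).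
Proof.
move=> f0; have [m [Q]] := multiplicity_XsubC P 0; rewrite P0 /= => Q0 PE.
have : root (Q - (Q.[0])%:P) 0 by rewrite rootE !hornerE subrr.
case/factor_theorem => B; rewrite subr0 => /eqP; rewrite subr_eq => /eqP BE.
exists Q.[0], (- B); split=> //; near=> x.
have : ev P (f x) x = 0 by near: x.
rewrite PE subr0 evM => /eqP; rewrite mulf_eq0 => /orP[|]; last first.
  by rewrite /ev hornerXn -rmorphXn /= hornerC expf_eq0 (negPf (f0 x)) andbF.
rewrite {1}BE evD evM evX evC evN addr_eq0 => /eqP E.
by rewrite -[X in - X](mulfK (f0 x)) E mulNr opprK.
Unshelve. all: by end_near.
Qed.

Lemma ratgerm_reduce u : ratgerm u -> exists r A,
  [/\ r != 0, (size A < size P)%N & \forall x \near (0:R)^'+, r.[x] * u x = ev A (f x) x].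
Proof.
move=> [r [A [r0 uA]]].
exists (lead_coef P ^+ scalp A P * r), (A %% P)%R; split.
- by rewrite mulf_neq0 // Pdiv.Idomain.lc_expn_scalp_neq0.
- by rewrite Pdiv.Idomain.ltn_modpN0.
near=> x; have Px : ev P (f x) x = 0 by near: x.
have := congr1 (fun A => ev A (f x) x) (Pdiv.Idomain.divp_eq A P).
rewrite /= evD evM Px mulr0 add0r => <-; rewrite evZ hornerM -mulrA.
by congr (_ * _); near: x.
Unshelve. all: by end_near.
Qed.

(** After pseudo-division by P each germ is described by (size P) - 1 coefficients, so [size P] of
    them are dependent over the polynomials in x. *)
Lemma ratgerm_lin_dep (u : nat -> R -> R) : (forall i, ratgerm (u i)) ->
  exists c : 'I_(size P) -> {poly R}, (exists i, c i != 0) /\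
    \forall x \near (0:R)^'+, \sum_i (c i).[x] * u i x = 0.
Proof.
move=> ru; have /choice[r /choice[A rA]] := fun i => ratgerm_reduce (ru i).
pose M := \matrix_(i < size P, j < (size P).-1) (A i)`_j.
have sP : (0 < size P)%N by rewrite size_poly_gt0.
have [c c0 cM] : exists2 c : 'rV__, c != 0 & c *m M = 0.
  by apply: lin_dep_idomain; rewrite prednK.
have cA : \sum_i c 0 i *: A i = 0.
  apply/polyP => j; rewrite coef_sum coef0.
  have [jP|jP] := ltnP j (size P).-1.
    have /rowP/(_ (Ordinal jP)) := cM; rewrite !mxE => E; rewrite -[RHS]E.
    by apply: eq_bigr => i _; rewrite coefZ mxE.
  rewrite big1 // => i _; rewrite coefZ nth_default ?mulr0 //.
  have [_ Ai _] := rA i; rewrite -ltnS (leq_trans Ai) //.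
  by move: jP; rewrite -ltnS prednK.
exists (fun i => c 0 i * r i); split.
  have [i ci] : exists i, c 0 i != 0.
    apply/existsP; apply: contraNT c0 => /existsPn H; apply/eqP/rowP => i.
    by rewrite mxE; apply/eqP; have := H i; rewrite negbK.
  by exists i; rewrite mulf_neq0 //; case: (rA i).
have H : \forall x \near (0:R)^'+, forall i : 'I_(size P), (r i).[x] * u i x = ev (A i) (f x) x.
  by apply: filter_forall => i; case: (rA i).
near=> x; have Hx : forall i : 'I_(size P), (r i).[x] * u i x = ev (A i) (f x) x by near: x.
have := congr1 (fun A => ev A (f x) x) cA.
rewrite /= ev0 ev_sum => E; rewrite -[RHS]E; apply: eq_bigr => i _.
by rewrite hornerM -mulrA Hx evZ.
Unshelve. all: by end_near.
Qed.

End Algebraic.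
End Rep.
End AlgebraicGerms.

Section Recurrence.
Variable R : realType.
Implicit Types (a e : nat -> R) (C x : R) (P : {poly {poly R}}).

Lemma near_is_derive_psum C e : 1 <= C -> geom_le C e ->
  \forall x \near (0:R)^'+, is_derive x (1:R) (psum e) (psum (pseries_diffs e) x).
Proof.
move=> C1 eC; near=> x; apply: (is_derive_psum C1 eC).
have [_ //] : 0 < x /\ 64 * C ^+ 4 * `|x| < 1.
near: x; apply: near0_pos_small; rewrite mulr_gt0 // exprn_gt0 //.
exact: lt_le_trans C1.
Unshelve. all: by end_near.
Qed.

Lemma near_psum_diffs C e : 1 <= C -> geom_le C e ->
  \forall x \near (0:R)^'+,
    x * psum (pseries_diffs e) x = psum (fun n => n%:R * e n) x.
Proof.
move=> C1 eC; have C0 : 0 < C by lra.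
have eC' := geom_le_natmul (ltW C0) eC.
have dC := geom_le_diffs C1 eC.
have C20 : 0 < 4 * C ^+ 2 by rewrite mulr_gt0 // exprn_gt0.
near=> x.
have [_ x1] : 0 < x /\ 2 * C * `|x| < 1.
  by near: x; apply: near0_pos_small; rewrite mulr_gt0.
have [_ x2] : 0 < x /\ 4 * C ^+ 2 * `|x| < 1 by near: x; exact: near0_pos_small.
have cS := is_cvg_pseries (ltW C20) dC x2.
rewrite [RHS](psumS _ eC' x1) ?mul0r ?add0r //.
by rewrite mulr_ge0 // ltW.
Unshelve. all: by end_near.
Qed.

Lemma geom_le_expmul C e i : 1 <= C -> geom_le C e ->
  exists2 D, 1 <= D & geom_le D (fun n => n%:R ^+ i * e n).
Proof.
move=> C1 eC; elim: i => [|i [D D1 IH]].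
  by exists C => // n; rewrite expr0 mul1r.
exists (2 * D); first by lra.
move=> n; have /= := geom_le_natmul (le_trans ler01 D1) IH n.
by rewrite [_ ^+ i.+1]exprS -mulrA.
Qed.

(** The germ x f'/f has coefficients a n, and applying x d/dx to it i times gives the coefficients
    n^i a n. All these germs stay rational in f, so finitely many of them satisfy a linear relation
    with coefficients in R[x]; the coefficient of x^N in this relation is the recurrence. *)
Lemma algebraic_recurrence a C P : 1 <= C -> geom_le C a -> a 0%N = 0 -> P != 0 ->
  (\forall x \near (0:R)^'+,
     ev P (expR (limn (series (fun n => a n.+1 * x ^+ n.+1 / n.+1%:R)))) x = 0) ->
  exists s (c : nat -> {poly R}), (exists2 j, (j <= s)%N & c j != 0) /\
    forall N, (s <= N)%N -> \sum_(j < s.+1) (c j).[(N - j)%:R] * a (N - j)%N = 0.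
Proof.
move=> C1 aC a0 P0 evP; have C0 : 0 < C by lra.
pose e n := a n / n%:R.
have eC : geom_le C e.
  move=> n; rewrite /e normrM; apply: le_trans (aC n).
  rewrite ler_piMr //; case: n => [|n]; first by rewrite invr0 normr0.
  by rewrite ger0_norm ?invr_ge0 // invf_le1 ?ler1n.
pose f x := expR (psum e x).
have evf : \forall x \near (0:R)^'+, ev P (f x) x = 0.
  have C20 : 0 < C ^+ 2 by rewrite exprn_gt0.
  near=> x.
  have [_ x1] : 0 < x /\ C * `|x| < 1 by near: x; exact: near0_pos_small.
  have [_ x2] : 0 < x /\ C ^+ 2 * `|x| < 1 by near: x; exact: near0_pos_small.
  have eC' := geom_le_shift C1 eC.
  have cS := is_cvg_pseries (ltW C20) eC' x2.
  have cE := is_cvg_pseries (ltW C0) eC x1.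
  rewrite /f; suff -> : psum e x =
      limn (series (fun n => a n.+1 * x ^+ n.+1 / n.+1%:R)) by near: x.
  have -> : psum e x = limn (fun n => pseries e x n.+1).
    by apply/esym/cvg_lim => //; rewrite cvg_shiftS; exact: cE.
  congr (limn _); apply/funext => n.
  rewrite /pseries /series /= big_nat_recl //= /e a0 !mul0r add0r.
  by apply: eq_bigr => i _; rewrite mulrAC.
have dE n : pseries_diffs e n = a n.+1.
  by rewrite /pseries_diffs /e mulrC divfK // pnatr_eq0.
have nE n : n%:R * e n = a n.
  by case: n => [|n]; [rewrite mul0r a0|exact: dE].
pose G x := psum (pseries_diffs e) x.
have df : \forall x \near (0:R)^'+, is_derive x (1:R) f (f x * G x).
  have dG := near_is_derive_psum C1 eC.
  near=> x; have dGx : is_derive x (1:R) (psum e) (psum (pseries_diffs e) x) by near: x.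
  rewrite /f; have := @is_derive1_comp _ (@expR R) (psum e) x _ _ (is_derive_expR _) dGx.
  by rewrite mulrC.
have rf' : ratgerm f (fun x => f x * G x) := ratgerm_derive_root df P0 evf.
have rf1 : ratgerm f (fun x => (f x)^-1).
  by apply: ratgerm_inv P0 evf _ => x; rewrite gt_eqF ?expR_gt0.
have rx : ratgerm f (fun x => x).
  by have := ratgerm_horner f 'X; congr ratgerm; apply/funext => x; rewrite hornerX.
pose ai i n := n%:R ^+ i * a n.
have aiC i := geom_le_expmul i C1 aC.
have ru i : ratgerm f (psum (ai i)).
  elim: i => [|i IH].
    have R0 := ratgermM rx (ratgermM rf' rf1); apply: ratgerm_near_eq R0.
    have H := near_psum_diffs C1 eC; near=> x.
    have -> : psum (ai 0%N) x = psum (fun n => n%:R * e n) x.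
      by congr (psum _ x); apply/funext => n; rewrite nE /ai expr0 mul1r.
    have <- : x * psum (pseries_diffs e) x = psum (fun n => n%:R * e n) x by near: x.
    congr (_ * _); rewrite mulrAC mulfV ?mul1r //.
    by rewrite gt_eqF // expR_gt0.
  have [D D1 aD] := aiC i.
  have dai := near_is_derive_psum D1 aD.
  have R1 := ratgermM rx (ratgerm_derive df P0 evf dai IH).
  apply: ratgerm_near_eq R1; have H := near_psum_diffs D1 aD.
  apply: filterS H => x ->; congr (psum _ x); apply/funext => n.
  by rewrite /ai mulrA -exprS.
have [c [[i0 ci0] cu]] := ratgerm_lin_dep P0 evf ru.
have gp i : germ_psum (conv_poly (c i) (ai i)) (fun x => (c i).[x] * psum (ai i) x).
  apply: germ_psumM; have [D D1 aD] := aiC i; exists D; split=> //.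
  exact: nearW.
have := germ_psum_eq0 (germ_psum_sum (index_enum _) gp) cu => E.
pose s := \max_(i < size P) size (c i).
have sc i j : (s <= j)%N -> (c i)`_j = 0.
  by move=> sj; apply: nth_default; apply: leq_trans sj; exact: leq_bigmax.
(* The relation is regrouped: [c i] is a polynomial in x, whereas [d j] is the polynomial in n that
   gathers the coefficients of x^j. The leading coefficient of the nonzero [c i0] reappears in some
   [d j], which is therefore nonzero. *)
pose d j := \sum_i (c i)`_j *: 'X^i : {poly R}.
exists s, d; split.
  exists (size (c i0)).-1; first by rewrite (leq_trans (leq_pred _)) // leq_bigmax.
  apply: contra ci0 => /eqP /(congr1 (fun p : {poly R} => p`_i0)).
  rewrite coef0 coef_sum (bigD1 i0) //= coefZ coefXn eqxx mulr1 big1 ?addr0.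
    by rewrite -lead_coefE => /eqP; rewrite lead_coef_eq0.
  by move=> i ii0; rewrite coefZ coefXn eq_sym [_ == _](negPf ii0) mulr0.
move=> N sN; rewrite -[RHS](E N) /conv_poly exchange_big /=.
rewrite (big_ord_widen N.+1 (fun j => (d j).[(N - j)%:R] * a (N - j)%N)) ?ltnS //.
rewrite big_mkcond /=; apply: eq_bigr => j _; case: ifP => js.
  rewrite /d horner_sum mulr_suml; apply: eq_bigr => i _.
  by rewrite hornerZ hornerXn /ai mulrA.
rewrite big1 // => i _; rewrite sc ?mul0r //.
by rewrite ltnW // ltnNge -ltnS js.
Unshelve. all: by end_near.
Qed.

End Recurrence.

(** * From the complex zeta function to a real germ *)

Section ComplexToReal.
Local Open Scope complex_scope.
Variable R : realType.
Local Notation C := (Cplx R).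
Local Notation toC := (fun x : R => (x%:C : C)).

Lemma cvg_real_complex (u : R^nat) l : u @ \oo --> l ->
  (fun n => toC (u n)) @ \oo --> toC l.
Proof.
move=> ul; apply/cvgrPdist_lt => e e0.
have [e1 ie] : 0 < complex.Re e /\ e = (complex.Re e)%:C.
  case: e e0 => a b; rewrite ltcE /= => /andP[/eqP -> a0]; by split.
move/cvgrPdist_lt: ul => /(_ _ e1); apply: filterS => n.
by rewrite -rmorphB ie /= normc_def /= expr0n /= addr0 sqrtr_sqr ltcR.
Qed.

Lemma limn_real_complex (u : R^nat) : cvgn u ->
  limn (fun n => toC (u n)) = toC (limn u).
Proof. by move=> cu; apply/cvg_lim => //; exact: cvg_real_complex. Qed.

Lemma cexp_real (x : R) : cexp (toC x) = toC (expR x).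
Proof.
rewrite /cexp.
have -> : series (fun n => toC x ^+ n / n`!%:R) = (fun n => toC (series (exp_coeff x) n)).
  apply/funext => n; rewrite /series /= rmorph_sum /=; apply: eq_bigr => i _.
  by rewrite /exp_coeff /= rmorphM rmorphXn fmorphV rmorph_nat.
by rewrite limn_real_complex //; exact: is_cvg_series_exp_coeff.
Qed.

(** Stated for an abstract R-linear [f] so as to serve both the real and the imaginary part. *)
Lemma Re_horner2 (f : {additive C -> R}) (P : {poly {poly C}}) (x y : R) :
  (forall z t, f (z * toC t) = f z * t) ->
  f P.[(toC y)%:P].[toC x] = ev (map_poly (map_poly f) P) y x.
Proof.
move=> fM.
have f1 (q : {poly C}) : f q.[toC x] = (map_poly f q).[x].
  elim/poly_ind: q => [|q c IH]; first by rewrite raddf0 !horner0 raddf0.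
  have -> : map_poly f (q * 'X + c%:P) = map_poly f q * 'X + (f c)%:P.
    apply/polyP => i; rewrite coef_map /= !coefD !coefMX !coefC raddfD /= coef_map /=.
    by case: i => [|i] /=; rewrite ?raddf0.
  by rewrite !hornerMXaddC raddfD /= fM IH.
elim/poly_ind: P => [|P c IH]; first by rewrite raddf0 /ev !horner0 raddf0.
have -> : map_poly (map_poly f) (P * 'X + c%:P) =
    map_poly (map_poly f) P * 'X + (map_poly f c)%:P.
  apply/polyP => i; rewrite coef_map /= !coefD !coefMX !coefC raddfD /= coef_map /=.
  by case: i => [|i] /=; rewrite ?raddf0.
by rewrite evD evM evC evX hornerMXaddC hornerD hornerM hornerC raddfD /= fM IH f1.
Qed.

(** At a real point zeta takes a real value, so the polynomials formed by the real and by the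
    imaginary parts of the coefficients of P both vanish there; they are not both zero. *)
Lemma algebraic_zeta_real (X : choiceType) (alpha : X -> X) (p : nat) :
  (0 < p)%N -> (forall n, card_periodic alpha n.+1 <= p ^ n.+1)%N ->
  algebraic_function_on [set z : Cplx R | `|z| < p%:R^-1] (dynamical_zeta alpha) ->
  exists2 P : {poly {poly R}}, P != 0 &
    \forall x \near (0:R)^'+, ev P (expR (limn (series
      (fun n => (card_periodic alpha n.+1)%:R * (x : R) ^+ n.+1 / n.+1%:R)))) x = 0.
Proof.
move=> p0 cp [P [P0 HP]].
have p0R : 0 < p%:R :> R by rewrite ltr0n.
have HR : \forall x \near (0:R)^'+, P.[((expR (limn (series
      (fun n => (card_periodic alpha n.+1)%:R * (x : R) ^+ n.+1 / n.+1%:R))))%:C)%:P].[x%:C] = 0.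
  near=> x.
  have [x0 x1] : 0 < x /\ p%:R * `|x| < 1 by near: x; exact: near0_pos_small.
  have xp : `|x%:C : Cplx R| < p%:R^-1.
    rewrite normc_def /= expr0n /= addr0 sqrtr_sqr.
    rewrite -[X in _ < X](_ : (p%:R^-1)%:C = _); last by rewrite fmorphV rmorph_nat.
    by rewrite ltcR -[X in _ < X]mul1r ltr_pdivlMr // mulrC.
  have := HP _ xp; congr (_.[(_)%:P].[_] = _).
  rewrite /dynamical_zeta -cexp_real; congr cexp.
  rewrite -limn_real_complex.
    congr (limn _); apply/funext => n; rewrite /series /= rmorph_sum /=.
    by apply: eq_bigr => i _; rewrite !rmorphM rmorphXn fmorphV !rmorph_nat.
  apply: normed_cvg.
  have px0 : 0 <= p%:R * `|x| by rewrite mulr_ge0 // ltW.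
  apply: (@series_le_cvg _ _ (geometric (p%:R * `|x|) (p%:R * `|x|))) => [n|n|n|].
  - exact: normr_ge0.
  - by rewrite /geometric /= mulr_ge0 // exprn_ge0.
  - rewrite /geometric /= -exprS exprMn normrM normfV normrM normrX ger0_norm //.
    rewrite (ger0_norm (ler0n _ _)) ler_pdivrMr ?ltr0n // -natrX.
    apply: (@le_trans _ _ ((p ^ n.+1)%:R * `|x| ^+ n.+1)).
      by rewrite ler_wpM2r ?exprn_ge0 // ler_nat.
    by rewrite ler_peMr ?mulr_ge0 ?exprn_ge0 // ler1n.
  - by apply: is_cvg_geometric_series; rewrite ger0_norm.
pose fR : {additive Cplx R -> R} := @complex.Re R.
pose fI : {additive Cplx R -> R} := @complex.Im R.
have RM z t : fR (z * t%:C) = fR z * t.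
  by case: z => a b; rewrite /fR /= mulr0 subr0.
have IM z t : fI (z * t%:C) = fI z * t.
  by case: z => a b; rewrite /fI /= mulr0 add0r.
have [PR0|PR0] := eqVneq (map_poly (map_poly fR) P) 0; last first.
  exists (map_poly (map_poly fR) P) => //; near=> x.
  by rewrite -(Re_horner2 _ _ _ RM) (near HR x) // raddf0.
exists (map_poly (map_poly fI) P); last first.
  by near=> x; rewrite -(Re_horner2 _ _ _ IM) (near HR x) // raddf0.
apply: contra P0 => /eqP PI0; apply/eqP/polyP => i; apply/polyP => j.
move: (congr1 (fun p : {poly {poly R}} => p`_i`_j) PR0).
move: (congr1 (fun p : {poly {poly R}} => p`_i`_j) PI0).
rewrite /= !coef0 !coef_map /=.
by rewrite /fR /fI; case: (P`_i`_j) => x y /= -> ->.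
Unshelve. all: by end_near.
Qed.

End ComplexToReal.

(** * Counting periodic points *)

(** A root of 1 + X + ... + X^(p-1) has order dividing p, and it is not 1, where the sum is p,
    nonzero in characteristic 0. *)
Lemma exists_prim_root_prime (C : numClosedFieldType) p : prime p ->
  exists z : C, p.-primitive_root z.
Proof.
move=> p_pr; have p1 := prime_gt1 p_pr.
have sz : size (\poly_(i < p) (1 : C)) = p.
  by rewrite size_poly_eq // oner_neq0.
have [|z /eqP z0] := closed_rootP (\poly_(i < p) (1 : C)) _.
  by rewrite sz; case: p p1 {p_pr sz} => [|[]].
have zS : \sum_(i < p) z ^+ i = 0.
  by rewrite -[RHS]z0 horner_poly; apply: eq_bigr => i _; rewrite mul1r.
have zp : z ^+ p = 1 by apply/eqP; rewrite -subr_eq0 subrX1 zS mulr0.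
have [m zm mp] := prim_order_exists (prime_gt0 p_pr) zp.
exists z; move: zm; have /primeP[_ /(_ m mp)/orP[/eqP ->|/eqP -> //]] := p_pr.
move=> /prim_expr_order; rewrite expr1 => z1; move: zS.
rewrite z1 (eq_bigr (fun=> 1)) => [|i _]; last by rewrite expr1n.
by rewrite sumr_const card_ord => /eqP; rewrite pnatr_eq0 -leqn0 leqNgt prime_gt0.
Qed.

Section PeriodicPoints.
Variables (R : realType) (p : nat) (v : nat -> finite_place p).
Variable omega : nat -> bool.
Hypothesis p_pr : prime p.
Local Notation A := (ring_omega v omega).
Local Notation inA := (in_ring_omega v omega).
Local Notation C := (Cplx R).

Let p1 : (1 < p)%N := prime_gt1 p_pr.

(** The survivors are the places with [omega k = false], those that constrain the ring; a nonzero
    [b] of this kind is a unit of it. *)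
Definition survivor_free (b : {poly 'F_p}) :=
  forall k, omega k = false -> ~~ (val (v k.+1) %| b).

Lemma in_ring_omega_poly (q : {poly 'F_p}) : q%:F \in inA.
Proof.
apply/in_ring_omegaP => // k _; exists q, 1; rewrite tofrac1 mulr1; split=> //.
by rewrite -(irreducible_poly_coprime _ (place_irr (v k.+1))) coprimep1.
Qed.

Lemma in_ring_omega_inv (b : {poly 'F_p}) : b != 0 -> survivor_free b ->
  (b%:F)^-1 \in inA.
Proof.
move=> b0 sb; apply/in_ring_omegaP => // k wk; exists 1, b.
by rewrite tofrac1 mulVf ?tofrac_eq0 // sb.
Qed.

(** Membership gives a fraction for each place separately; reducing to lowest terms yields a single
    one that is good at all survivors. *)
Lemma ring_omega_frac f : f \in inA -> exists a b : {poly 'F_p},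
  f * b%:F = a%:F /\ survivor_free b.
Proof.
move/(in_ring_omegaP _ _ _ p1) => fA.
have d0 := den_neq0 f; pose c := gcdp (Defs.num f) (den f).
have c0 : c != 0 by rewrite gcdp_eq0 (negPf d0) andbF.
have nE : Defs.num f %/ c * c = Defs.num f by rewrite divpK // dvdp_gcdl.
have dE : den f %/ c * c = den f by rewrite divpK // dvdp_gcdr.
have cop : coprimep (Defs.num f %/ c) (den f %/ c).
  by apply: coprimep_div_gcd; rewrite d0 orbT.
have fE : f * (den f %/ c)%:F = (Defs.num f %/ c)%:F.
  have cF : c%:F != 0 :> ratfun p by rewrite tofrac_eq0.
  by apply: (mulIf cF); rewrite -mulrA -!tofracM dE nE ratfun_numden.
exists (Defs.num f %/ c), (den f %/ c); split=> // k wk.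
have [a [b [fb nb]]] := fA _ wk.
have E : Defs.num f %/ c * b = a * (den f %/ c).
  by apply/eqP; rewrite -tofrac_eq !tofracM -fb -fE mulrAC.
apply: contra nb => /dvdp_trans; apply.
by rewrite -(@Gauss_dvdpr _ _ (Defs.num f %/ c)) 1?coprimep_sym // E dvdp_mull.
Qed.

Section Quotient.
Variables (n : nat) (g h : {poly 'F_p}).
Hypothesis gh : 'X^n - 1 = g * h.
Hypothesis g0 : g != 0.
Hypothesis h0 : h != 0.
Hypothesis sh : survivor_free h.
Hypothesis sg : forall b, survivor_free b -> coprimep b g.
Local Notation d := (size g).-1.

(** With f = a / b and u b + w g = 1, f is congruent to u a modulo g, and Euclidean division
    finishes. Together with [rem_unique] this identifies A / gA with F_p[t] / g. *)
Lemma rem_exists (f : A) : exists s : {poly 'F_p}, (size s < size g)%N /\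
  exists f' : A, val f = s%:F + g%:F * val f'.
Proof.
have [a [b [fb sb]]] := ring_omega_frac (valP f).
have /Bezout_eq1_coprimepP[[u w] /= uw] := sg sb.
exists ((u * a) %% g); split; first by rewrite ltn_modp.
have f'A : ((u * a) %/ g)%:F + w%:F * val f \in inA.
  by rewrite rpredD ?rpredM ?in_ring_omega_poly //; exact: valP.
exists (RingOmega f'A) => /=.
have E1 : (u * a)%:F = ((u * a) %% g)%:F + g%:F * ((u * a) %/ g)%:F.
  by rewrite -tofracM -tofracD {1}(divp_eq (u * a) g) addrC [g * _]mulrC.
have E2 : val f = (u * a)%:F + g%:F * (w%:F * val f).
  rewrite tofracM -fb -[LHS]mul1r -tofrac1 -uw tofracD !tofracM; ring.
by rewrite {1}E2 E1 mulrDr addrA.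
Qed.

Lemma rem_unique (s : {poly 'F_p}) (f' : A) : s%:F = g%:F * val f' -> g %| s.
Proof.
move=> E; have [a [b [fb sb]]] := ring_omega_frac (valP f').
have sE : s * b = g * a.
  by apply/eqP; rewrite -tofrac_eq !tofracM E -mulrA fb.
by rewrite -(@Gauss_dvdpl _ _ b) ?sE ?dvdp_mulr // coprimep_sym sg.
Qed.

Lemma rem_unique_size (s : {poly 'F_p}) (f' : A) : (size s < size g)%N ->
  s%:F = g%:F * val f' -> s = 0.
Proof.
move=> sz /rem_unique dv; apply/eqP; apply: contraTT sz => s0.
by rewrite -leqNgt dvdp_leq.
Qed.

Lemma remP : exists r : A -> {poly 'F_p}, forall f,
  (size (r f) < size g)%N /\ exists f' : A, val f = (r f)%:F + g%:F * val f'.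
Proof. by have [r rP] := choice rem_exists; exists r. Qed.

Definition poly_omega (q : {poly 'F_p}) : A := RingOmega (in_ring_omega_poly q).

Lemma poly_omegaD q s : poly_omega (q + s) = poly_omega q + poly_omega s.
Proof. by apply: val_inj; rewrite /= tofracD. Qed.

Lemma iter_alpha m (x : X_omega R v omega) (f : A) :
  iter m (@alpha_omega R p v omega) x f = x (poly_omega 'X^m * f).
Proof.
elim: m f => [|m IH] f /=.
  by congr (character_fun x _); apply: val_inj; rewrite /= expr0 tofrac1 mul1r.
rewrite IH; congr (character_fun x _); apply: val_inj.
by rewrite /= exprSr tofracM -mulrA.
Qed.

Lemma dual_ext (x y : X_omega R v omega) : (forall f, x f = y f) -> x = y.
Proof.
case: x => x x1 xD; case: y => y y1 yD /= /funext xy.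
by subst y; congr Character; exact: Prop_irrelevance.
Qed.

Lemma char0 (x : X_omega R v omega) : x 0 = 1.
Proof.
have x0 : x 0 != 0 by rewrite -normr_eq0 character_circle oner_neq0.
by apply: (mulfI x0); rewrite -characterD addr0 mulr1.
Qed.

Lemma char_natmul (x : X_omega R v omega) f m : x (f *+ m) = x f ^+ m.
Proof. by elim: m => [|m IH]; rewrite ?mulr0n ?char0 // mulrS exprS characterD IH. Qed.

Lemma mulr_gE (f : A) : g%:F * val f = ('X^n - 1)%:F * ((h%:F)^-1 * val f).
Proof. by rewrite gh tofracM -mulrA mulVKf // tofrac_eq0. Qed.

(** The points of period n are the characters that are trivial on (t^n - 1) A = gA. [Phi] lists
    them: a linear form [c] on remainders modulo g, followed by the character [chi] of F_p attached
    to a primitive p-th root of unity. *)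
Lemma card_periodicE : card_periodic (@alpha_omega R p v omega) n = (p ^ d)%N.
Proof.
have gd : d.+1 = size g by rewrite prednK // size_poly_gt0.
have [z zp] := exists_prim_root_prime C p_pr.
pose chi (a : 'F_p) : C := z ^+ (a : nat).
have chiM (a : nat) : z ^+ (a %% (Zp_trunc (pdiv p)).+2) = z ^+ a.
  by rewrite Fp_cast // prim_expr_mod.
have chiD a b : chi (a + b) = chi a * chi b.
  by rewrite /chi -exprD -(chiM (a + b)%N).
have chi_mul a b : chi (a * b) = chi a ^+ (b : nat).
  by rewrite /chi -exprM -(chiM (a * b)%N).
have z1 : `|z| = 1.
  apply/eqP; rewrite -(pexpr_eq1 (prime_gt0 p_pr)) // -normrX.
  by rewrite (prim_expr_order zp) normr1.
have chi1 a : `|chi a| = 1 by rewrite /chi normrX z1 expr1n.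
have chi_inj : injective chi.
  move=> a b /eqP; rewrite (eq_prim_root_expr zp) => /eqP ab; apply: val_inj.
  by move: ab; rewrite !modn_small // -[X in (_ < X)%N](Fp_cast p_pr) ltn_ord.
have [r rP] := remP.
have rE (f : A) (s : {poly 'F_p}) (f' : A) : (size s < size g)%N ->
    val f = s%:F + g%:F * val f' -> r f = s.
  move=> sz fE; have [rsz [f'' rf]] := rP f.
  apply/eqP; rewrite -subr_eq0; apply/eqP.
  apply: (@rem_unique_size _ (f' - f'')).
    by rewrite (leq_ltn_trans (size_polyD _ _)) // size_polyN gtn_max rsz.
  rewrite tofracB /=; apply/eqP; rewrite mulrBr subr_eq addrAC eq_sym subr_eq.
  by rewrite eq_sym -rf fE addrC.
have rD (f1 f2 : A) : r (f1 + f2) = r f1 + r f2.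
  have [s1 [g1 e1]] := rP f1; have [s2 [g2 e2]] := rP f2.
  apply: (rE _ _ (g1 + g2)).
    by rewrite (leq_ltn_trans (size_polyD _ _)) // gtn_max s1.
  have valD (a b : A) : val (a + b) = val a + val b by [].
  by rewrite !valD e1 e2 tofracD mulrDr addrACA.
pose lam (c : {ffun 'I_d -> 'F_p}) (s : {poly 'F_p}) := \sum_(i < d) c i * s`_i.
have lamD c s t : lam c (s + t) = lam c s + lam c t.
  by rewrite -big_split; apply: eq_bigr => i _; rewrite coefD mulrDr.
have circ c f : `|chi (lam c (r f))| = 1 by [].
have hom c : {morph (fun f => chi (lam c (r f))) : f1 f2 / f1 + f2 >-> f1 * f2}.
  by move=> f1 f2; rewrite rD lamD chiD.
pose Phi c : X_omega R v omega := Character (circ c) (hom c).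
have rX (i : 'I_d) : r (poly_omega 'X^i) = 'X^i.
  apply: (rE _ _ 0); first by rewrite size_polyXn (leq_trans _ (eq_leq gd)) // ltnS.
  by rewrite /= mulr0 addr0.
have PhiX c (i : 'I_d) : Phi c (poly_omega 'X^i) = chi (c i).
  rewrite /= rX /lam (bigD1 i) //= coefXn eqxx mulr1 big1 ?addr0 // => j ji.
  by rewrite coefXn -(inj_eq val_inj) /= in ji *; rewrite (negPf ji) mulr0.
have Phi_inj : injective Phi.
  move=> c c' E; apply/ffunP => i; apply: chi_inj.
  by rewrite -!PhiX E.
have Phi_per c : periodic_points (@alpha_omega R p v omega) n (Phi c).
  apply: dual_ext => f; rewrite iter_alpha /=; congr (chi (lam c _)).
  have [s1 [f' e1]] := rP f.
  apply: (rE _ _ (f' + poly_omega h * f)) => //=.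
  have E : ('X^n)%:F = 1 + g%:F * h%:F :> ratfun p.
    by rewrite -tofracM -gh -tofrac1 -tofracD addrC subrK.
  by rewrite -/(val _) E mulrDl mul1r {1}e1 mulrDr addrA mulrA.
have per_Phi x : periodic_points (@alpha_omega R p v omega) n x -> exists c, x = Phi c.
  move=> xper.
  (* Multiples of g are multiples of t^n - 1, because h is a unit; and x takes equal values at t^n
     f3 and f3. *)
  have xg (f1 f2 : A) : val f1 = g%:F * val f2 -> x f1 = 1.
    move=> E; pose f3 : A := RingOmega (in_ring_omega_inv h0 sh) * f2.
    have -> : f1 = poly_omega 'X^n * f3 - f3.
      by apply: val_inj; rewrite E mulr_gE /= tofracB tofrac1 mulrBl mul1r.
    have x0 : x (- f3) != 0 by rewrite -normr_eq0 character_circle oner_neq0.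
    rewrite characterD -(iter_alpha n) xper.
    by rewrite -characterD subrr char0.
  have xr i : exists c, x (poly_omega 'X^i) = chi c.
    have [|k ->] := prim_rootP zp (_ : x (poly_omega 'X^i) ^+ p = 1).
      rewrite -char_natmul -[RHS](char0 x); congr (character_fun x _).
      apply: val_inj; rewrite raddfMn /= -tofracMn.
      by rewrite -mulr_natl -polyC_natr pchar_Fp_0 // mul0r tofrac0.
    exists (inZp k); rewrite /chi /= (chiM k) //.
  have /choice[c0 xc] := xr.
  exists [ffun i : 'I_d => c0 i]; apply: dual_ext => f.
  have [s1 [f' e1]] := rP f.
  have fE : f = poly_omega (r f) + poly_omega g * f' by apply: val_inj.
  rewrite {1}fE characterD (xg (poly_omega g * f') f') // mulr1.
  have polyMn (q : {poly 'F_p}) m : poly_omega (q *+ m) = poly_omega q *+ m.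
    elim: m => [|m IH]; last by rewrite !mulrS poly_omegaD IH.
    by rewrite !mulr0n; apply: val_inj; rewrite /= tofrac0.
  have xZ (a : 'F_p) i : x (poly_omega (a *: 'X^i)) = chi (c0 i * a).
    rewrite -[a in a *: _]natr_Zp scaler_nat polyMn char_natmul xc.
    by rewrite chi_mul.
  have xS (q : {poly 'F_p}) m : x (poly_omega (\sum_(i < m) q`_i *: 'X^i)) =
      chi (\sum_(i < m) c0 i * q`_i).
    elim: m => [|m IH]; last by rewrite !big_ord_recr poly_omegaD characterD IH xZ /= chiD.
    rewrite !big_ord0 /chi expr0 -(char0 x); congr (character_fun x _).
    by apply: val_inj; rewrite /= tofrac0.
  have rfE : r f = \sum_(i < d) (r f)`_i *: 'X^i.
    rewrite -poly_def; apply/polyP => i; rewrite coef_poly; case: ltnP => // di.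
    rewrite nth_default // -ltnS (leq_trans (rP f).1) // -gd ltnS //.
  rewrite {1}rfE xS /=; congr chi; apply: eq_bigr => i _.
  by rewrite ffunE.
rewrite /card_periodic.
have -> : periodic_points (@alpha_omega R p v omega) n = range Phi.
  apply/seteqP; split=> [x /per_Phi[c ->]|x [c _ <-]]; last exact: Phi_per.
  by exists c.
have fin : finite_set (range Phi) by apply: finite_image; exact: finite_finset.
have -> : fset_set (range Phi) = [fset Phi c | c in {: {ffun 'I_d -> 'F_p}}]%fset.
  apply/fsetP => x; rewrite in_fset_set //; apply/idP/imfsetP => [|[c _ ->]].
    by rewrite inE => -[c _ <-]; exists c.
  by rewrite inE; exists c.
by rewrite card_imfset //= -cardE card_ffun card_Fp // card_ord.
Qed.

End Quotient.
End PeriodicPoints.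

(** * Orders, multiplicities and degrees of the places dividing t^n - 1 *)

(** [d] is the order of the image of X in the finite field F_p[X] / q, whose unit group has p^(deg
    q) - 1 elements. *)
Lemma poly_order (p : nat) (q : {poly 'F_p}) : prime p ->
  q \is monic -> irreducible_poly q -> ~~ (q %| 'X) ->
  exists d, [/\ (0 < d)%N, forall m, (q %| 'X^m - 1) = (d %| m)%N &
    (d %| (p ^ (size q).-1).-1)%N].
Proof.
move=> p_pr qm qi qX.
have mi : monic_irreducible_poly q by [].
have mk : mk_monic q = q by rewrite mk_monicE.
have eq0 (s : {poly 'F_p}) : (in_qpoly q s == 0) = (q %| s).
  apply/eqP/idP => [/val_eqP /=|dv].
    by rewrite -Pdiv.IdomainMonic.modpE mk.
  by apply/val_eqP; rewrite /= -Pdiv.IdomainMonic.modpE mk.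
pose x : {poly %/ q with mi} := in_qpoly q 'X.
have x0 : x != 0 by rewrite /x eq0.
have xE m : (x ^+ m == 1) = (q %| 'X^m - 1).
  by rewrite -eq0 rmorphB rmorphXn rmorph1 subr_eq0.
have card : #|{poly %/ q with mi}| = (p ^ (size q).-1)%N.
  by rewrite card_qfpoly card_Fp.
have card1 := card_qfpoly_gt1 mi.
have xc : x ^+ (p ^ (size q).-1).-1 = 1.
  apply: (mulfI x0); rewrite -exprS mulr1 -card prednK ?(ltnW card1) //.
  exact: expf_card.
have [|d xd dv] := prim_order_exists _ xc; first by rewrite -card; case: #|_| card1 => [|[]].
exists d; split=> //; first exact: prim_order_gt0 xd.
by move=> m; rewrite -xE (prim_order_dvd xd).
Qed.

Lemma irreducible_divisor (F : fieldType) (q : {poly F}) : (1 < size q)%N ->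
  exists s : {poly F}, [/\ s \is monic, irreducible_poly s & s %| q].
Proof.
have [n] := ubnP (size q); elim: n q => // n IH q qn q1.
have q0 : q != 0 by rewrite -size_poly_gt0 (ltn_trans _ q1).
have [ir|nir] := pselect (irreducible_poly q).
  have c0 : (lead_coef q)^-1 != 0 by rewrite invr_eq0 lead_coef_eq0.
  exists ((lead_coef q)^-1 *: q); split.
  - by rewrite monicE lead_coefZ mulVf ?lead_coef_eq0.
  - have e := eqp_scale q c0; split; first by rewrite (eqp_size e).
    move=> t t1 dt; have dq : t %| q by rewrite -(eqp_dvdr _ e).
    by apply: eqp_trans (ir.2 _ t1 dq) _; rewrite eqp_sym.
  - by rewrite dvdpZl.
have [t [t1 tq te]] : exists t : {poly F}, [/\ size t != 1%N, t %| q & ~~ (t %= q)].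
  apply: contrapT => H; apply: nir; split=> // t t1 tq.
  by apply: contrapT => /negP te; apply: H; exists t.
have st : (size t < size q)%N.
  by rewrite ltn_neqAle dvdp_leq // andbT dvdp_size_eqp.
have t2 : (1 < size t)%N.
  rewrite ltn_neqAle eq_sym t1 size_poly_gt0.
  by apply: contraTneq tq => ->; rewrite dvd0p.
have [|s [sm si sd]] := IH t _ t2; first by rewrite (leq_trans st).
by exists s; split=> //; exact: dvdp_trans sd tq.
Qed.

Section Multiplicity.
Variables (p : nat) (v : {poly 'F_p}).
Hypothesis p_pr : prime p.
Hypothesis vi : irreducible_poly v.
Hypothesis vX : ~~ (v %| 'X).

Lemma Xn_sub1_neq0 n : (0 < n)%N -> 'X^n - 1 != 0 :> {poly 'F_p}.
Proof. by move=> n0; rewrite -size_poly_gt0 size_XnsubC. Qed.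

Lemma irr_dvdXn m : (v %| 'X^m) = false.
Proof.
apply/negbTE; rewrite -(irreducible_poly_coprime _ vi).
by apply: coprimep_expr; rewrite irreducible_poly_coprime.
Qed.

Lemma dvdp_exp_Xn_sub1 m j : ~~ (p %| m)%N -> v ^+ j %| 'X^m - 1 -> (j <= 1)%N.
Proof.
move=> pm; case: j => [|[|j]] // dv; exfalso.
have : v ^+ 2 %| 'X^m - 1 by apply: dvdp_trans dv; rewrite dvdp_exp2l.
case/dvdpP => s E; have : v %| ('X^m - 1)^`().
  rewrite E derivM expr2 derivM dvdp_add // dvdp_mull //; first exact: dvdp_mulIr.
  by rewrite dvdp_add // ?dvdp_mulIr ?dvdp_mulIl.
rewrite derivB derivXn -[1]/(1%:P) derivC subr0 -scaler_nat dvdpZr ?irr_dvdXn //.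
by rewrite -(dvdn_pcharf (pchar_Fp p_pr)).
Qed.

Lemma Xn_sub1_Frobenius m a :
  'X^(p ^ a * m) - 1 = ('X^m - 1) ^+ (p ^ a) :> {poly 'F_p}.
Proof.
have ch : p \in [pchar {poly 'F_p}].
  by rewrite pchar_poly pchar_Fp.
have FB (x : {poly 'F_p}) : x ^+ p - 1 = (x - 1) ^+ p.
  have := pFrobenius_autB_comm ch (commr1 x).
  by rewrite !pFrobenius_autE expr1n => ->.
elim: a m => [|a IH] m; first by rewrite expn0 mul1n.
by rewrite expnSr -mulnA IH (mulnC p m) exprM FB -exprM (mulnC p).
Qed.

(** With n = p^a m and m prime to p, Frobenius gives X^n - 1 = (X^m - 1)^(p^a), and X^m - 1 is prime
    to its derivative at v, so v divides it at most once. *)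
Lemma dvdp_exp_Xn_sub1_logn n j : (0 < n)%N -> v ^+ j %| 'X^n - 1 ->
  (j <= p ^ logn p n)%N.
Proof.
move=> n0 dv; have [m pm nE] := pfactor_coprime p_pr n0.
move: dv; rewrite {1}nE mulnC Xn_sub1_Frobenius; set P := (p ^ logn p n)%N => dv.
have m0 : (0 < m)%N by move: n0; rewrite nE muln_gt0 => /andP[].
have pm' : ~~ (p %| m)%N by rewrite -prime_coprime.
have X0 := Xn_sub1_neq0 m0.
have [s vs E] : exists2 s, ~~ (v %| s) & exists2 e, (e <= 1)%N & 'X^m - 1 = v ^+ e * s.
  have [/dvdpP[s E]|nv] := boolP (v %| 'X^m - 1); last first.
    by exists ('X^m - 1) => //; exists 0%N; rewrite ?mul1r.
  exists s; last by exists 1%N; rewrite // E mulrC.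
  apply/negP => /dvdpP[t tE].
  suff : (2 <= 1)%N by [].
  by apply: dvdp_exp_Xn_sub1 pm' _; rewrite E tE -mulrA dvdp_mull.
have {E}[e e1 E] := E.
move: dv; rewrite E exprMn -exprM mulrC Gauss_dvdpr; last first.
  by rewrite coprimep_expl // coprimep_expr // irreducible_poly_coprime.
rewrite dvdp_Pexp2l; last by case: vi.
move/leq_trans; apply; rewrite -[X in (_ <= X)%N]mul1n leq_mul2r e1 orbT //.
Qed.
End Multiplicity.

Section Weights.
Variables (p : nat) (v : nat -> finite_place p).
Hypotheses (p_pr : prime p) (hv : place_enumeration v).
Local Notation plc k := (val (v k.+1)).

Definition place_mult n k := ord_poly (plc k) ('X^n - 1).
(* The contribution of the k-th place to log_p |F_n| when that place survives. *)
Definition place_weight n k := ((size (plc k)).-1 * place_mult n k)%N.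

Lemma plc_monic k : plc k \is monic.
Proof. by case: (v k.+1) => q /= /andP[]. Qed.

Lemma plc_size k : (0 < (size (plc k)).-1)%N.
Proof. by have [+ _] := place_irr (v k.+1); case: size => [|[]]. Qed.

Lemma plc_dvd_irr k (q : {poly 'F_p}) : q \is monic -> irreducible_poly q ->
  plc k %| q -> plc k = q.
Proof.
move=> qm qi dv; apply/eqP; rewrite -eqp_monic ?plc_monic //.
by apply: qi.2 dv; have [+ _] := place_irr (v k.+1); case: size => [|[]].
Qed.

Lemma plc_X k : ~~ (plc k %| 'X).
Proof.
apply/negP => dv; have [[w vK _] v0] := hv.
have irrX : irreducible_poly ('X : {poly 'F_p}).
  by rewrite -['X]subr0; exact: irredp_XsubC.
have E : plc k = val (v 0) by rewrite v0; exact: plc_dvd_irr (monicX _) irrX dv.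
by move/val_inj/(can_inj vK): E.
Qed.

Lemma plc_coprime j k : j != k -> coprimep (plc j) (plc k).
Proof.
move=> jk; rewrite irreducible_poly_coprime; last exact: place_irr.
apply: contra jk => dv; have [[w vK _] v0] := hv.
have E := plc_dvd_irr (plc_monic k) (place_irr (v k.+1)) dv.
by move/val_inj/(can_inj vK): E => -[->].
Qed.

Lemma place_multP n k j : (0 < n)%N -> (plc k ^+ j %| 'X^n - 1) = (j <= place_mult n k)%N.
Proof. by move=> n0; rewrite ord_polyP // Xn_sub1_neq0. Qed.

Definition place_part (P : pred nat) n K :=
  \prod_(0 <= k < K | P k) plc k ^+ place_mult n k.

Lemma place_part_neq0 P n K : place_part P n K != 0.
Proof.
rewrite prodf_seq_neq0; apply/allP => k _; apply/implyP => _.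
by rewrite expf_neq0 // monic_neq0 // plc_monic.
Qed.

Lemma place_partS (P : pred nat) n K : place_part P n K.+1 =
  place_part P n K * (if P K then plc K ^+ place_mult n K else 1).
Proof. by rewrite /place_part big_mkcond big_nat_recr //= -big_mkcond. Qed.

Lemma place_part_coprime (P : pred nat) n K (b : {poly 'F_p}) :
  (forall k, (k < K)%N -> P k -> coprimep b (plc k)) -> coprimep b (place_part P n K).
Proof.
elim: K => [|K IH] H; first by rewrite /place_part big_geq // coprimep1.
rewrite place_partS coprimepMr IH /=.
  by case: ifP => PK; rewrite ?coprimep1 // coprimep_expr // H.
by move=> k kK; apply: H; rewrite ltnS ltnW.
Qed.

Lemma size_place_part (P : pred nat) n K :
  (size (place_part P n K)).-1 = (\sum_(0 <= k < K | P k) place_weight n k)%N.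
Proof.
elim: K => [|K IH]; first by rewrite /place_part !big_geq // size_poly1.
have := place_part_neq0 P n K.
rewrite place_partS => g0.
have -> : (\sum_(0 <= k < K.+1 | P k) place_weight n k)%N =
    (\sum_(0 <= k < K | P k) place_weight n k + if P K then place_weight n K else 0)%N.
  by rewrite big_mkcond big_nat_recr //= -big_mkcond.
rewrite -IH; case: ifP => PK; last by rewrite mulr1 addn0.
have e0 : plc K ^+ place_mult n K != 0 by rewrite expf_neq0 // monic_neq0 // plc_monic.
rewrite size_mul // /place_weight -size_exp.
by move: g0 e0; rewrite -!size_poly_gt0; case: size => // a; case: size => // b; rewrite addnS.
Qed.

Lemma place_part_dvd (P : pred nat) n K : (0 < n)%N -> place_part P n K %| 'X^n - 1.
Proof.
move=> n0; elim: K => [|K IH]; first by rewrite /place_part big_geq // dvd1p.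
rewrite place_partS; case: ifP => PK; last by rewrite mulr1.
rewrite Gauss_dvdp; first by rewrite IH /= place_multP.
rewrite coprimep_sym place_part_coprime // => k kK _.
by rewrite coprimep_expl // plc_coprime // gtn_eqF.
Qed.

Lemma sum_place_weight_le (P : pred nat) n K : (0 < n)%N ->
  (\sum_(0 <= k < K | P k) place_weight n k <= n)%N.
Proof.
move=> n0; rewrite -size_place_part.
have := dvdp_leq (Xn_sub1_neq0 p n0) (place_part_dvd P K n0).
by rewrite size_XnsubC //; case: size.
Qed.

(** The partial sums of the weights are bounded by n; past an index where they reach their maximum,
    every weight is zero. *)
Lemma place_weight_support n : (0 < n)%N ->
  exists K, forall k, (K <= k)%N -> place_weight n k = 0%N.
Proof.
move=> n0; pose S K := (\sum_(0 <= k < K) place_weight n k)%N.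
have [m /asboolP[K SK] mmax] : {m | `[< exists K, S K = m >] &
    forall m', `[< exists K, S K = m' >] -> (m' <= m)%N}.
  have ex : exists m, `[< exists K, S K = m >] by exists (S 0%N); apply/asboolP; exists 0%N.
  have ub m : `[< exists K, S K = m >] -> (m <= n)%N.
    by move=> /asboolP[K <-]; exact: sum_place_weight_le.
  by case: (ex_maxnP ex ub) => m; exists m.
exists K => k Kk.
have : (S k.+1 <= S K)%N by rewrite SK mmax //; apply/asboolP; exists k.+1.
have : (S K <= S k)%N by rewrite /S [leqRHS](big_cat_nat (n := K)) //= leq_addr.
by rewrite {3}/S big_nat_recr //= -/(S k) => h1 h2; lia.
Qed.

Lemma place_weight0 n k : (place_weight n k == 0%N) = (place_mult n k == 0%N).
Proof. by rewrite muln_eq0 gtn_eqF // plc_size. Qed.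

Lemma place_cofactor (P : pred nat) n K : (0 < n)%N ->
  (forall k, (K <= k)%N -> place_weight n k = 0%N) ->
  exists h, [/\ 'X^n - 1 = place_part P n K * h, h != 0 &
    forall k, P k -> ~~ (plc k %| h)].
Proof.
move=> n0 hK; have /dvdpP[h E] := place_part_dvd P K n0.
exists h; split; first by rewrite mulrC.
  by have := Xn_sub1_neq0 p n0; rewrite E mulf_eq0 negb_or => /andP[].
move=> k Pk; apply/negP => /dvdpP[s hE].
have [kK|Kk] := ltnP k K.
  suff : (place_mult n k < place_mult n k)%N by rewrite ltnn.
  rewrite -place_multP // E hE exprSr mulrAC dvdp_mul // dvdp_mull //.
  by rewrite /place_part big_mkord (bigD1 (Ordinal kK)) //= dvdp_mulIl.
have /eqP := hK k Kk; rewrite place_weight0 => /eqP m0.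
have : (1 <= place_mult n k)%N.
  by rewrite -place_multP // expr1 E hE mulrAC dvdp_mulIr.
by rewrite m0.
Qed.

(** An irreducible factor of the cofactor would be an enumerated place. It is none of those indexed
    by k, whose full powers were divided out, and it is not t, which does not divide t^n - 1; so the
    cofactor is constant. *)
Lemma sum_place_weight n K : (0 < n)%N ->
  (forall k, (K <= k)%N -> place_weight n k = 0%N) ->
  (\sum_(0 <= k < K) place_weight n k)%N = n.
Proof.
move=> n0 hK; have [h [E h0 hP]] := place_cofactor xpredT n0 hK.
have sh : size h = 1%N.
  apply/eqP; rewrite eqn_leq size_poly_gt0 h0 andbT leqNgt; apply/negP => h1.
  have [s [sm si sd]] := irreducible_divisor h1.
  have [[w vK wK] v0] := hv.
  have sP : (s \is monic) && irreducibleb s by rewrite sm; exact/irreducibleP.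
  have := wK (exist _ s sP); case: (w _) => [|k] /(congr1 val) /= Es.
    have : ('X : {poly 'F_p}) %| 'X^n - 1.
      by rewrite E dvdp_mull // -v0 -[\val _]/(sval _) Es.
    have X0 : 'X = 'X - (0:'F_p)%:P by rewrite subr0.
    rewrite {1}X0 dvdp_XsubCl rootE hornerD hornerN hornerXn hornerC expr0n gtn_eqF // sub0r.
    by rewrite oppr_eq0 oner_eq0.
  by have := hP k isT; rewrite -[\val _]/(sval (v k.+1)) Es sd.
have := congr1 (fun q : {poly 'F_p} => size q) E.
rewrite /= size_XnsubC // size_mul ?place_part_neq0 // sh addn1 /= => En.
by have := size_place_part xpredT n K; rewrite -En => /= <-.
Qed.

Lemma card_periodic_weight (R : realType) omega n K : (0 < n)%N ->
  (forall k, (K <= k)%N -> place_weight n k = 0%N) ->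
  card_periodic (@alpha_omega R p v omega) n =
    (p ^ \sum_(0 <= k < K | ~~ omega k) place_weight n k)%N.
Proof.
move=> n0 hK; have [h [E h0 hP]] := place_cofactor (fun k => ~~ omega k) n0 hK.
rewrite -size_place_part; apply: (card_periodicE (omega := omega) R p_pr E _ h0).
- exact: place_part_neq0.
- by move=> k wk; apply: hP; rewrite wk.
- move=> b sb; apply: place_part_coprime => k _ wk; rewrite coprimep_sym.
  rewrite irreducible_poly_coprime; last exact: place_irr.
  by apply: sb; apply/negbTE.
Qed.

(* d k is the multiplicative order of t modulo the k-th place. *)
Definition place_order_spec (d : nat -> nat) := forall k,
  [/\ (0 < d k)%N, forall m, (0 < m)%N -> (0 < place_weight m k)%N = (d k %| m)%N,
    (d k %| (p ^ (size (plc k)).-1).-1)%N &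
    forall m, (0 < m)%N -> ~~ (p %| m)%N -> (d k %| m)%N ->
      place_weight m k = (size (plc k)).-1].

Lemma place_orderP : exists d, place_order_spec d.
Proof.
have H k := poly_order p_pr (plc_monic k) (place_irr (v k.+1)) (plc_X k).
have [d dP] := choice H; exists d => k; have [d0 dm dp] := dP k.
have W m : (0 < m)%N -> (0 < place_weight m k)%N = (d k %| m)%N.
  by move=> m0; rewrite lt0n place_weight0 -lt0n -place_multP // expr1 dm.
split=> // m m0 pm /[dup] dkm; rewrite -W // lt0n place_weight0 -lt0n => m1.
rewrite /place_weight; suff -> : place_mult m k = 1%N by rewrite muln1.
apply/eqP; rewrite eqn_leq m1 andbT.
apply: (dvdp_exp_Xn_sub1 p_pr (place_irr (v k.+1)) (plc_X k) pm).
by rewrite place_multP.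
Qed.

Lemma place_weight_logn n k : (0 < n)%N ->
  (place_weight n k <= (size (plc k)).-1 * p ^ logn p n)%N.
Proof.
move=> n0; rewrite leq_mul2l; apply/orP; right.
apply: (dvdp_exp_Xn_sub1_logn p_pr (place_irr (v k.+1)) (plc_X k) n0).
by rewrite place_multP.
Qed.

End Weights.

(** * Averages over finitely many coordinates *)

Section Averaging.
Variables (R : realFieldType) (rho : R).
Hypothesis rho01 : 0 < rho < 1.
Implicit Types (w : nat -> bool) (f g : (nat -> bool) -> R) (J L : seq nat).

Definition upd w j b : nat -> bool := fun i => if i == j then b else w i.

(* The conditional expectation that averages over coordinate j, the other ones being frozen. *)
Definition avg1 j f w := rho * f (upd w j false) + (1 - rho) * f (upd w j true).

Definition avg J f := foldr avg1 f J.

Definition indep_of J f := forall w w', {in predC (mem J), w =1 w'} -> f w = f w'.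

Definition incr f := forall w w', (forall i, w i ==> w' i) -> f w <= f w'.

Let rho0 : 0 <= rho. Proof. by case/andP: rho01 => /ltW. Qed.
Let rho1 : 0 <= 1 - rho. Proof. by case/andP: rho01 => _; rewrite subr_ge0 => /ltW. Qed.

Lemma avg_cat J L f : avg (J ++ L) f = avg J (avg L f).
Proof. exact: foldr_cat. Qed.

Lemma avg_le J f g : (forall w, f w <= g w) -> forall w, avg J f w <= avg J g w.
Proof.
move=> fg; elim: J => //= j J IH w.
by rewrite /avg1 lerD // ler_wpM2l.
Qed.

Lemma avg_eq J f g : (forall w, f w = g w) -> forall w, avg J f w = avg J g w.
Proof.
move=> fg; elim: J => //= j J IH w.
by rewrite /avg1 !IH.
Qed.

Lemma avgD J f g w : avg J (fun w => f w + g w) w = avg J f w + avg J g w.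
Proof. by elim: J w => //= j J IH w; rewrite /avg1 !IH; ring. Qed.

Lemma avgZ J a f w : avg J (fun w => a * f w) w = a * avg J f w.
Proof. by elim: J w => //= j J IH w; rewrite /avg1 !IH; ring. Qed.

Lemma avg_cst J a w : avg J (fun=> a) w = a.
Proof. by elim: J w => //= j J IH w; rewrite /avg1 !IH; ring. Qed.

Lemma avg_sum J (I : Type) (r : seq I) (F : I -> (nat -> bool) -> R) w :
  avg J (fun w => \sum_(i <- r) F i w) w = \sum_(i <- r) avg J (F i) w.
Proof.
elim: r => [|i r IH].
  by rewrite big_nil -[RHS](avg_cst J 0 w); apply: avg_eq => w'; rewrite big_nil.
by rewrite big_cons -IH -avgD; apply: avg_eq => w'; rewrite big_cons.
Qed.

Lemma avgM_indep J f g : indep_of J f ->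
  forall w, avg J (fun w => f w * g w) w = f w * avg J g w.
Proof.
elim: J => //= j J IH fJ w.
have fJ' : indep_of J f.
  by move=> w1 w2 E; apply: fJ => i; rewrite !inE negb_or => /andP[_ /E].
rewrite /avg1 !IH //.
have E b : f (upd w j b) = f w.
  by apply: fJ => i; rewrite !inE negb_or /upd => /andP[/negPf ->].
by rewrite !E; ring.
Qed.

Lemma upd_le w w' j b : (forall i, w i ==> w' i) -> forall i, upd w j b i ==> upd w' j b i.
Proof. by move=> ww i; rewrite /upd; case: ifP => // _; exact: implybb. Qed.

Lemma incr_avg J f : incr f -> incr (avg J f).
Proof.
move=> fi; elim: J => //= j J IH w w' ww; rewrite /avg1.
by rewrite lerD // ler_wpM2l // IH //; apply: upd_le.
Qed.

(* Harris' inequality. *)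
Lemma avgM_ge J f g : incr f -> incr g ->
  forall w, avg J f w * avg J g w <= avg J (fun w => f w * g w) w.
Proof.
move=> fi gi; elim: J => //= j J IH w.
have ft w' b : upd w' j false b ==> upd w' j true b.
  by rewrite /upd; case: ifP => // _; exact: implybb.
have h1 := incr_avg J fi (ft w); have h2 := incr_avg J gi (ft w).
rewrite /avg1; have := IH (upd w j false); have := IH (upd w j true).
move: h1 h2; set a := avg J f _; set b := avg J f _; set c := avg J g _.
set d := avg J g _; set x := avg J _ _; set y := avg J _ _ => ab cd h1 h2.
apply: (@le_trans _ _ (rho * (a * c) + (1 - rho) * (b * d))); last first.
  by rewrite lerD // ler_wpM2l.
(* Chebyshev's identity for one two-valued coordinate: the covariance is rho (1 - rho) (b - a) (d -
   c). Both increments are nonnegative because averaging over the other coordinates preserves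
   monotonicity. *)
rewrite -subr_ge0.
have -> : rho * (a * c) + (1 - rho) * (b * d) -
   (rho * a + (1 - rho) * b) * (rho * c + (1 - rho) * d) =
   rho * (1 - rho) * ((b - a) * (d - c)) by ring.
by rewrite !mulr_ge0 // subr_ge0.
Qed.

Lemma avg_prod_ge J (I : eqType) (r : seq I) (F : I -> (nat -> bool) -> R) a w :
  (forall i, incr (F i)) -> (forall i w, 0 <= F i w) -> 0 <= a ->
  {in r, forall i, a <= avg J (F i) w} ->
  a ^+ size r <= avg J (fun w => \prod_(i <- r) F i w) w.
Proof.
move=> Fi F0 a0 aF.
have Pi s : incr (fun w => \prod_(i <- s) F i w).
  move=> w1 w2 ww; elim: s => [|i s IH]; rewrite ?big_nil // !big_cons.
  by rewrite ler_pM ?Fi // prodr_ge0.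
elim: r aF => [|i r IH] aF; first by rewrite expr0 -[leLHS](avg_cst J 1 w);
  apply: avg_le => w'; rewrite big_nil.
have aFi : a <= avg J (F i) w by apply: aF; rewrite mem_head.
have {}IH := IH (fun j jr => aF j (mem_behead (s := i :: r) jr)).
apply: le_trans (_ : avg J (F i) w * avg J (fun w => \prod_(i <- r) F i w) w <= _).
  by rewrite /= exprS ler_pM ?exprn_ge0.
apply: le_trans (avgM_ge J (Fi i) (Pi r) w) _.
by apply: avg_le => w'; rewrite big_cons.
Qed.

Lemma avg_coord J k w : uniq J -> k \in J -> avg J (fun w => (~~ w k)%:R) w = rho.
Proof.
elim: J w => //= j J IH w /andP[jJ uJ]; rewrite inE => /predU1P[->|kJ]; last first.
  by rewrite /avg1 !IH //; ring.
have indj : indep_of J (fun w => (~~ w j)%:R).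
  by move=> w1 w2 -> //; rewrite !inE.
have E b : avg J (fun w0 => (~~ w0 j)%:R) (upd w j b) = (~~ b)%:R.
  rewrite (avg_eq J (g := fun w0 => (~~ w0 j)%:R * 1)); last by move=> ?; rewrite mulr1.
  by rewrite avgM_indep // avg_cst mulr1 /upd eqxx.
by rewrite /avg1 !E /=; ring.
Qed.

Lemma avg_all_false J w : uniq J ->
  avg J (fun w => (all (fun k => ~~ w k) J)%:R) w = rho ^+ size J.
Proof.
elim: J w => //= j J IH w /andP[jJ uJ].
have indj : indep_of J (fun w => (~~ w j)%:R).
  by move=> w1 w2 -> //; rewrite !inE.
have E b : avg J (fun w0 => (~~ w0 j && all (fun k => ~~ w0 k) J)%:R) (upd w j b) =
    (~~ b)%:R * rho ^+ size J.
  rewrite (avg_eq J (g := fun w0 => (~~ w0 j)%:R * (all (fun k => ~~ w0 k) J)%:R)).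
    by rewrite avgM_indep // IH // /upd eqxx.
  by move=> w'; case: (~~ _) => /=; rewrite ?mul1r ?mul0r.
by rewrite /avg1 !E exprS /=; ring.
Qed.

End Averaging.

(** * Events depending on finitely many coordinates *)

Section ProductMeasure.
Variables (R : realType) (rho : R) (mu : probability Omega R).
Hypotheses (hrho : 0 < rho < 1) (hmu : is_product_measure rho mu).
Implicit Types (A B : pred (nat -> bool)) (J L : seq nat) (w s : nat -> bool).

Definition depends_on J A := forall w w', {in J, w =1 w'} -> A w = A w'.

Lemma measurable_coord k b : measurable ([set w | w k = b] : set Omega).
Proof. by apply: sub_sigma_algebra; exists k, b. Qed.

Lemma depends_on_upd j J A b : depends_on (j :: J) A ->
  depends_on J (fun w => A (upd w j b)).
Proof.
move=> dA w w' ww; apply: dA => i; rewrite inE /upd.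
by case: eqP => //= _; exact: ww.
Qed.

Lemma depends_on_split j J A : depends_on (j :: J) A ->
  forall w, A w = A (upd w j (w j)).
Proof. by move=> dA w; apply: dA => i _; rewrite /upd; case: eqP => // ->. Qed.

Lemma measurable_depends_on J A : depends_on J A ->
  measurable ([set w | A w] : set Omega).
Proof.
elim: J A => [|j J IH] A dA.
  have [a0|a0] := boolP (A xpredT).
    rewrite (_ : mkset _ = setT) ?seteqP; first exact: measurableT.
    by split=> // w _ /=; rewrite (dA w xpredT).
  rewrite (_ : mkset _ = set0) ?seteqP; first exact: measurable0.
  by split=> // w /=; rewrite (dA w xpredT) // (negPf a0).
have -> : [set w | A w] = ([set w | w j = false] `&` [set w | A (upd w j false)]) `|`
    ([set w | w j = true] `&` [set w | A (upd w j true)]).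
  apply/seteqP; split=> w /=; first by rewrite (depends_on_split dA);
    case E: (w j); [right|left].
  by case=> -[E]; rewrite -{1}E -(depends_on_split dA).
by apply: measurableU; apply: measurableI;
  (exact: measurable_coord || (apply: IH; exact: depends_on_upd)).
Qed.

Definition cyl L s : set Omega := [set w | forall k, k \in L -> w k = s k].

Lemma measurable_cyl L s : measurable (cyl L s).
Proof.
have -> : cyl L s = [set w | all (fun k => w k == s k) L].
  apply/seteqP; split=> w /= H; first by apply/allP => k /H ->.
  by move=> k kL; have /allP/(_ k kL)/eqP := H.
apply: (@measurable_depends_on L) => w w' ww.
by apply: eq_in_all => k kL; rewrite ww.
Qed.

(** The coordinates in L are frozen at s and those in J averaged. The induction splits on one
    coordinate of J and moves it to L; when J is exhausted, what remains is the cylinder formula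
    that defines the measure. *)
Lemma mu_cyl_avg J L A s : uniq (J ++ L) -> depends_on (J ++ L) A ->
  mu ([set w | A w] `&` cyl L s) =
  (avg rho J (fun w => (A w)%:R) s * \prod_(k <- L) (if s k then 1 - rho else rho))%:E.
Proof.
elim: J L s => [|j J IH] L s uL dA.
  rewrite /=; case As: (A s); last first.
    rewrite mul0r (_ : _ `&` _ = set0) ?measure0 // -subset0 => w [/= Aw cw].
    by move: Aw; rewrite (dA w s) ?As // => k kL; exact: cw.
  rewrite mul1r -(hmu s uL); congr (mu _); apply/seteqP; split=> w /=; first by case.
  by move=> cw; split=> //; rewrite (dA w s).
move: uL => /= /andP[]; rewrite mem_cat negb_or => /andP[jJ jL] uL.
have uL' : uniq (J ++ j :: L).
  by rewrite -cat_rcons -cats1 -catA uniq_catCA /= mem_cat negb_or jJ jL.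
have dA' : depends_on (J ++ j :: L) A.
  move=> w w' ww; apply: dA => k kL; apply: ww; move: kL.
  by rewrite /= !(inE, mem_cat) orbCA.
have E b : mu ([set w | A w] `&` cyl (j :: L) (upd s j b)) =
    (avg rho J (fun w => (A w)%:R) (upd s j b) *
     ((if b then 1 - rho else rho) * \prod_(k <- L) (if s k then 1 - rho else rho)))%:E.
  rewrite IH // big_cons (_ : upd s j b j = b) ?/upd ?eqxx //; congr ((_ * (_ * _))%:E).
  apply: eq_big_seq => k kL; rewrite /upd; case: eqP => // kj.
  by move: jL; rewrite -kj kL.
have -> : [set w | A w] `&` cyl L s =
    ([set w | A w] `&` cyl (j :: L) (upd s j false)) `|`
    ([set w | A w] `&` cyl (j :: L) (upd s j true)).
  apply/seteqP; split=> w /=.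
    move=> [Aw cw]; case wj: (w j); [right|left]; split=> // k; rewrite inE /upd;
    by case: eqP => [->|_] //=; exact: cw.
  case=> -[Aw cw]; split=> // k kL; rewrite cw ?inE ?kL ?orbT // /upd;
  by case: eqP => // kj; move: jL; rewrite -kj kL.
have mA := measurable_depends_on dA.
rewrite measureU /=; first 1 last.
- by apply: measurableI => //; exact: measurable_cyl.
- by apply: measurableI => //; exact: measurable_cyl.
- rewrite -subset0 => w /= [[_ c1] [_ c2]].
  have := c1 j (mem_head _ _); rewrite (c2 j (mem_head _ _)) /upd eqxx //.
by rewrite !E -EFinD /avg1; congr (_%:E); ring.
Qed.

Lemma mu_avg J A w : uniq J -> depends_on J A ->
  mu [set w | A w] = (avg rho J (fun w => (A w)%:R) w)%:E.
Proof.
move=> uJ dA; have := @mu_cyl_avg J [::] A w; rewrite cats0 big_nil mulr1.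
move=> <- //; congr (mu _); apply/seteqP; split=> x //= [] //.
Qed.

Lemma avg_indep_depends J L A (g : (nat -> bool) -> R) : depends_on J A ->
  (forall k, k \in L -> k \notin J) ->
  forall w, avg rho L (fun w => (A w)%:R * g w) w = (A w)%:R * avg rho L g w.
Proof.
move=> dA LJ; apply: avgM_indep => w w' ww; congr ((_ : bool)%:R).
by apply: dA => k kJ; apply: ww; rewrite !inE; apply: contraL kJ; exact: LJ.
Qed.

(* A substitute for Borel-Cantelli without independence: whatever finite set J of coordinates
   has been revealed, some later trial succeeds with conditional probability at least c. *)
Lemma negligible_no_success (T : Type) (Good : T -> pred (nat -> bool)) (c : R) :
  0 < c ->
  (forall J, uniq J -> exists t L, [/\ uniq L, forall k, k \in L -> k \notin J,
     depends_on (J ++ L) (Good t) &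
     forall w, c <= avg rho L (fun w => (Good t w)%:R) w]) ->
  mu.-negligible [set w : Omega | forall t, ~~ Good t w].
Proof.
move=> c0 H.
have c1 : c <= 1.
  have [t [L [_ _ _ /(_ xpredT)]]] := H [::] isT; move/le_trans; apply.
  rewrite -[leRHS](avg_cst rho L 1 xpredT); apply: (avg_le hrho) => w.
  by rewrite lern1 leq_b1.
(* [A] is the event that n chosen trials fail, and J the coordinates revealed by them; whatever
   their values, the next trial fails with probability at most 1 - c. *)
have step n : exists J A, [/\ uniq J, depends_on J A,
    [set w : Omega | forall t, ~~ Good t w] `<=` [set w | A w] &
    (mu [set w | A w] <= ((1 - c) ^+ n)%:E)%E].
  elim: n => [|n [J [A [uJ dA sA mA]]]].
    exists [::], xpredT; split=> //.
    by rewrite expr0; apply: probability_le1; exact: (@measurable_depends_on [::]).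
  have [t [L [uL LJ dG cG]]] := H J uJ.
  exists (J ++ L), (fun w => A w && ~~ Good t w).
  have uJL : uniq (J ++ L).
    by rewrite cat_uniq uJ uL andbT /=; apply/hasPn => k /LJ.
  have dB : depends_on (J ++ L) (fun w => A w && ~~ Good t w).
    move=> w w' ww; rewrite (dG w w' ww); congr (_ && _); apply: dA => k kJ.
    by apply: ww; rewrite mem_cat kJ.
  split=> //; first by move=> w gw /=; rewrite (sA _ gw) gw.
  rewrite (mu_avg xpredT uJL dB) lee_fin avg_cat.
  move: mA; rewrite (mu_avg xpredT uJ dA) lee_fin => mA.
  rewrite exprS; apply: le_trans (ler_wpM2l _ mA); last by rewrite subr_ge0.
  rewrite -avgZ; apply: (avg_le hrho) => w.
  have -> : avg rho L (fun w => (A w && ~~ Good t w)%:R) w =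
      (A w)%:R * (1 - avg rho L (fun w => (Good t w)%:R) w).
    have -> : 1 - avg rho L (fun w => (Good t w)%:R) w =
        avg rho L (fun w => 1 + -1 * (Good t w)%:R) w.
      by rewrite avgD avgZ avg_cst mulN1r.
    rewrite -(avg_indep_depends _ dA LJ); apply: avg_eq => w'.
    by case: (A w'); case: (Good t w'); rewrite /= ?mulr0n ?mulr1n; ring.
  by rewrite mulrC ler_wpM2r // lerD2l lerN2.
have /choice[J /choice[A HA]] := step.
exists (\bigcap_n [set w : Omega | A n w]); split; last first.
- by move=> w gw n _; have [_ _ + _] := HA n; exact.
- apply/eqP; rewrite eq_le measure_ge0 andbT.
  apply/lee_addgt0Pr => e e0; rewrite add0e.
  have : (1 - c) ^+ n @[n --> \oo] --> (0:R).
    by apply: cvg_expr; rewrite ger0_norm ?subr_ge0 // ltrBlDr ltrDl.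
  move=> /cvgr0_norm_lt /(_ e e0) [N _ /(_ N (leqnn N))] /=.
  rewrite ger0_norm ?exprn_ge0 ?subr_ge0 // => Ne.
  have [_ dA _ mA] := HA N; apply: le_trans (le_trans mA _).
    apply: le_measure; rewrite ?inE; last exact: bigcap_inf.
      by apply: bigcap_measurable => // n _; have [_ dA' _ _] := HA n;
        exact: measurable_depends_on dA'.
    exact: measurable_depends_on dA.
  by rewrite lee_fin ltW.
- by apply: bigcap_measurable => // n _; have [_ dA _ _] := HA n; exact: measurable_depends_on dA.
Qed.

End ProductMeasure.

(** * Isolated peaks of the periodic point counts *)

Lemma shift_bounds n m i r : (i <= r)%N -> (r < n)%N ->
  (m = n + i \/ n = m + i)%N -> (0 < m)%N && (m <= n + r)%N.
Proof. by move=> ir rn [->|nE]; lia. Qed.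

Lemma leq_sum_parts (a b c d e k : nat) : (a + b + c + d + e < k)%N ->
  [/\ a <= k, b <= k, c <= k, d <= k & e <= k]%N.
Proof. by move=> h; split; lia. Qed.

Section Peaks.
Variables (p : nat) (v : nat -> finite_place p).
Hypotheses (p_pr : prime p) (hv : place_enumeration v).
Local Notation deg k := (size (val (v k.+1))).-1.
Local Notation wt := (place_weight v).
Variable d : nat -> nat.
Hypothesis dP : place_order_spec v d.
Variable K : nat -> nat.
Hypothesis KP : forall n k, (0 < n)%N -> (K n <= k)%N -> wt n k = 0%N.

(* log_p |F_n| for the sample point w; coordinate [true] removes a place. *)
Definition surv_weight n (w : nat -> bool) := (\sum_(0 <= k < K n | ~~ w k) wt n k)%N.

Lemma order_lt_support n j : (0 < n)%N -> (d j %| n)%N -> (j < K n)%N.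
Proof.
move=> n0; have [_ W _ _] := dP j; rewrite -W // => wj; rewrite ltnNge.
by apply/negP => Kj; move: wj; rewrite KP.
Qed.

Variable q : nat.
Hypotheses (q_pr : prime q) (q_odd : odd q) (pq : p != q).
Let q0 : (0 < q)%N := prime_gt0 q_pr.
Let q1 : (1 < q)%N := prime_gt1 q_pr.

Lemma p_ndvd_expq k : ~~ (p %| q ^ k)%N.
Proof. by rewrite Euclid_dvdX // negb_and dvdn_prime2 // pq. Qed.

(** These are the factors of t^(q^k) - 1 that do not divide t^(q^(k-1)) - 1. *)
Definition primitive_places k := [seq j <- iota 0 (K (q ^ k)) | d j == q ^ k]%N.

Lemma mem_primitive_places k j : (j \in primitive_places k) = (d j == q ^ k)%N.
Proof.
rewrite mem_filter mem_iota /= add0n; case: eqP => //= dj.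
by rewrite order_lt_support ?expn_gt0 ?q0 // dj.
Qed.

Lemma size_primitive_places : exists c, forall k, (c <= k)%N ->
  (size (primitive_places k) <= q ^ c)%N.
Proof.
have qp : ~~ (q %| p)%N by rewrite dvdn_prime2 // eq_sym.
have [c cP] := pow_dvd_exponent q_pr q_odd (prime_gt1 p_pr) qp.
exists c => k ck; have n0 : (0 < q ^ k)%N by rewrite expn_gt0 q0.
have qk : (0 < q ^ (k - c))%N by rewrite expn_gt0 q0.
rewrite -(leq_pmul2r qk) -expnD subnKC //.
apply: leq_trans _ (sum_place_weight_le hv (fun j => d j == q ^ k)%N (K (q ^ k)) n0).
rewrite -big_filter /index_iota subn0 -/(primitive_places k).
rewrite -sum1_size big_distrl /= big_seq [leqRHS]big_seq; apply: leq_sum => j.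
rewrite mem_primitive_places => /eqP dj; have [_ _ dv E] := dP j.
rewrite mul1n E ?p_ndvd_expq ?dj //; apply: dvdn_leq; first exact: plc_size.
by apply: cP; [exact: plc_size|rewrite -dj].
Qed.

(** A lost place of nonzero weight has order dividing q^(k-1), and it has the same weight for
    q^(k-1), both exponents being prime to p. The weights for q^(k-1) add up to at most q^(k-1). *)
Lemma surv_weight_primitive k w : (0 < k)%N ->
  all (fun j => ~~ w j) (primitive_places k) ->
  (q ^ k <= surv_weight (q ^ k) w + q ^ k.-1)%N.
Proof.
move=> k0 /allP wP; have n0 : (0 < q ^ k)%N by rewrite expn_gt0 q0.
have n1 : (0 < q ^ k.-1)%N by rewrite expn_gt0 q0.
rewrite -{1}(sum_place_weight hv n0 (fun j => KP (k := j) n0)).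
rewrite (bigID (fun j => ~~ w j)) /= leq_add2l.
apply: leq_trans _ (sum_place_weight_le hv (fun j => ~~ ~~ w j) (K (q ^ k)) n1).
apply: leq_sum => j wj; have [dj W _ E] := dP j.
have [dn|dn] := boolP (d j %| q ^ k)%N; last first.
  by move: dn; rewrite -W // lt0n negbK => /eqP ->.
have dn1 : (d j %| q ^ k.-1)%N.
  have /(dvdn_pfactor _ _ q_pr)[i ik di] := dn; rewrite di.
  apply: dvdn_exp2l; rewrite -ltnS prednK // ltn_neqAle ik andbT.
  by apply: contra wj => /eqP ik'; rewrite wP // mem_primitive_places di ik'.
by rewrite !E ?p_ndvd_expq.
Qed.

Definition window n r := [seq m <- iota (n - r) (2 * r).+1 | m != n].

Lemma size_window n r : (size (window n r) <= (2 * r).+1)%N.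
Proof. by rewrite size_filter -[leqRHS](size_iota (n - r)) count_size. Qed.

Lemma window_shift n r m : (r < n)%N -> m \in window n r ->
  exists2 i, (0 < i <= r)%N & (m = n + i \/ n = m + i)%N.
Proof.
move=> rn; rewrite mem_filter mem_iota => /and3P[mn h1 h2].
have [le|lt] := leqP m n; first by exists (n - m)%N; lia.
by exists (m - n)%N; lia.
Qed.

Lemma mem_window n r m : (r < n)%N -> (m <= n + r)%N -> (n <= m + r)%N -> m != n ->
  m \in window n r.
Proof. by move=> rn h1 h2 mn; rewrite mem_filter mem_iota mn; lia. Qed.

Variable r : nat.
Hypothesis rq : (r < q)%N.

(* The two conditions give b n >= (1 - 1/q) n and b m <= (1 - 2/q) n for n = q^k and m <> n
   in the window. *)
Definition peak k (w : nat -> bool) :=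
  all (fun j => ~~ w j) (primitive_places k) &&
  all (fun m => q * surv_weight m w + 2 * q ^ k <= q * q ^ k)%N (window (q ^ k)%N r).

Lemma peakP k w m : (0 < k)%N -> (r < q ^ k)%N -> peak k w ->
  (m <= q ^ k + r)%N -> (q ^ k <= m + r)%N -> m != (q ^ k)%N ->
  (q * surv_weight m w + q ^ k <= q * surv_weight (q ^ k) w)%N.
Proof.
move=> k0 rn /andP[/(surv_weight_primitive k0) h1 /allP h2] m1 m2 mn.
have h3 := h2 m (mem_window rn m1 m2 mn).
have : (q * q ^ k <= q * surv_weight (q ^ k) w + q ^ k)%N.
  have e : (q ^ k = q * q ^ k.-1)%N by rewrite -expnS prednK.
  by rewrite [X in (_ <= _ + X)%N]e -mulnDr leq_mul2l h1 orbT.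
move=> h4; lia.
Qed.

Lemma surv_weight_depends m (J : seq nat) : (forall j, (j < K m)%N -> j \in J) ->
  forall w w', {in J, w =1 w'} -> surv_weight m w = surv_weight m w'.
Proof.
move=> KJ w w' ww; rewrite /surv_weight big_nat_cond [RHS]big_nat_cond.
apply: eq_bigl => j; case: (ltnP j (K m)) => //= jK; rewrite ?andbF //.
by rewrite ww // KJ.
Qed.

Section Conditional.
Variables (R : realType) (rho : R).
Hypothesis hrho : 0 < rho < 1.
Hypothesis rhoq : rho <= 1 - 4 / q%:R.

(** Places in L survive with probability rho; those in J are frozen and, at worst, all survive,
    which costs D. *)
Lemma avg_surv_weight_le (J L : seq nat) m w D : uniq L -> (0 < m)%N ->
  (\sum_(0 <= j < K m | j \in J) wt m j <= D)%N ->
  (forall j, (j < K m)%N -> (0 < wt m j)%N -> (j \in L) || (j \in J)) ->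
  avg rho L (fun w => (surv_weight m w)%:R) w <= rho * m%:R + D%:R.
Proof.
move=> uL m0 DJ LJ.
have E w' : (surv_weight m w')%:R = \sum_(0 <= j < K m) (wt m j)%:R * (~~ w' j)%:R :> R.
  rewrite /surv_weight natr_sum big_mkcond; apply: eq_bigr => j _.
  by case: (w' j); rewrite ?mulr0 ?mulr1.
rewrite (avg_eq _ _ E) avg_sum.
apply: le_trans (_ : \sum_(0 <= j < K m) (rho * (wt m j)%:R +
    (if j \in J then (wt m j)%:R else 0)) <= _).
  rewrite big_nat_cond [leRHS]big_nat_cond; apply: ler_sum => j /andP[/andP[_ jK] _].
  rewrite avgZ; have [jL|jL] := boolP (j \in L).
    by rewrite avg_coord // mulrC lerDl; case: ifP.
  have w0 : 0 <= rho * (wt m j)%:R by rewrite mulr_ge0 //; case/andP: hrho => /ltW.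
  have [wt0|wt0] := posnP (wt m j); first by rewrite wt0 mul0r mulr0 add0r; case: ifP.
  have := LJ j jK wt0; rewrite (negPf jL) /= => ->.
  apply: le_trans (_ : (wt m j)%:R <= _); last by rewrite lerDr.
  rewrite ler_piMr // -[leRHS](avg_cst rho L 1 w).
  by apply: (avg_le hrho) => w'; case: (w' j).
rewrite big_split /= -big_mkcond -mulr_sumr -!natr_sum.
rewrite (sum_place_weight hv m0 (fun j => KP (k := j) m0)).
by rewrite lerD2l ler_nat.
Qed.

Lemma avg_window_ge (L : seq nat) m w D k :
  avg rho L (fun w => (surv_weight m w)%:R) w <= rho * m%:R + D%:R ->
  (m <= q ^ k + r)%N -> (q * (r + D) <= q ^ k)%N -> (2 < q)%N ->
  q%:R^-1 <=
    avg rho L (fun w => (q * surv_weight m w + 2 * q ^ k <= q * q ^ k)%N%:R) w.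
Proof.
move=> Eb mn nD q2; set n := (q ^ k)%N in mn nD *.
have n0 : 0 < n%:R :> R by rewrite ltr0n expn_gt0 q0.
have qR : 2 < q%:R :> R by rewrite (ltr_nat R 2 q).
have qR0 : 0 < q%:R :> R by lra.
(* Markov in pointwise form: the indicator is at least 1 - (q / T) b m, where T / q = (1 - 2/q) n is
   the threshold. The mean is at most (1 - 3/q) n, and (q - 3) / (q - 2) <= 1 - 1/q. *)
pose T : R := n%:R * (q%:R - 2).
have T0 : 0 < T by rewrite mulr_gt0 // subr_gt0.
apply: le_trans (_ : avg rho L (fun w => 1 + (- (q%:R / T)) * (surv_weight m w)%:R) w <= _).
  rewrite avgD avg_cst avgZ.
  have h1 : m%:R <= n%:R + r%:R :> R by rewrite -natrD ler_nat.
  have h2 : q%:R * (r%:R + D%:R) <= n%:R :> R by rewrite -natrD -natrM ler_nat.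
  have [rho0 rho1] := andP hrho.
  have h3 : rho * q%:R <= q%:R - 4.
    move: rhoq; rewrite -(ler_pM2r qR0) mulrBl mul1r divfK // gt_eqF //.
  set a := avg _ _ _ _ in Eb *.
  have a_le : q%:R * a <= n%:R * (q%:R - 3).
    apply: le_trans (_ : q%:R * (rho * (n%:R + r%:R) + D%:R) <= _).
      rewrite ler_pM2l // (le_trans Eb) // lerD2r ler_pM2l //.
    have r0 : 0 <= r%:R :> R by [].
    have h4 : q%:R * (rho * (n%:R + r%:R) + D%:R) <=
        n%:R * (rho * q%:R) + q%:R * (r%:R + D%:R).
      have : q%:R * (rho * r%:R) <= q%:R * r%:R by rewrite ler_pM2l // ler_piMl // ltW.
      lra.
    apply: le_trans h4 _.
    have : n%:R * (rho * q%:R) <= n%:R * (q%:R - 4) by rewrite ler_pM2l.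
    lra.
  have h5 : q%:R / T * a <= 1 - q%:R^-1.
    rewrite mulrAC ler_pdivrMr //; apply: le_trans a_le _; rewrite /T.
    have -> : (1 - q%:R^-1) * (n%:R * (q%:R - 2)) =
      n%:R * (q%:R - 3) + 2 * n%:R / q%:R :> R.
      by field; rewrite gt_eqF.
    by rewrite lerDl !mulr_ge0 // ?invr_ge0 ltW.
  by rewrite mulNr; lra.
apply: (avg_le hrho) => w'; rewrite mulNr.
have [le|lt] := leqP.
  by rewrite lerBlDr lerDl mulr_ge0 // divr_ge0 // ltW.
rewrite subr_le0 mulrAC ler_pdivlMr // mul1r /T.
have : (q * n)%:R <= (q * surv_weight m w' + 2 * n)%:R :> R by rewrite ler_nat ltnW.
rewrite natrD !natrM; lra.
Qed.

Lemma incr_window m k :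
  incr (fun w => (q * surv_weight m w + 2 * q ^ k <= q * q ^ k)%N%:R : R).
Proof.
move=> w w' ww; rewrite ler_nat; case: (leqP (_ + _)%N) => // le.
suff : (surv_weight m w' <= surv_weight m w)%N.
  move=> h; rewrite (leq_trans _ le) // leq_add2r leq_mul2l h orbT //.
rewrite /surv_weight big_mkcond [leqRHS]big_mkcond; apply: leq_sum => j _.
by have := ww j; case: (w j); case: (w' j).
Qed.

End Conditional.

Lemma negligible_no_peak (R : realType) (rho : R) (mu : probability Omega R) N0 :
  0 < rho < 1 -> is_product_measure rho mu -> rho <= 1 - 4 / q%:R -> (2 < q)%N ->
  mu.-negligible [set w : Omega | forall t, ~~ peak (N0 + t) w].
Proof.
move=> hrho hmu rhoq q2; have [c cP] := size_primitive_places.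
have [rho0 rho1] := andP hrho.
have qR0 : 0 < q%:R :> R by rewrite ltr0n.
have qR1 : q%:R^-1 <= 1 :> R by rewrite invf_le1 // ler1n.
(* At most q^c primitive places have to survive, and at most 2 r + 1 window events have to occur,
   each with conditional probability at least 1/q. *)
pose c' : R := q%:R^-1 ^+ (2 * r).+1 * rho ^+ (q ^ c).
apply: (negligible_no_success hrho hmu (c := c')).
  by rewrite mulr_gt0 // exprn_gt0 // invr_gt0.
move=> J uJ.
(* [D] bounds the contribution of the revealed places to b m, their multiplicities being at most the
   p-part of m, hence at most q + r. *)
pose D0 := (\sum_(j <- J) deg j)%N; pose D := (D0 * (q + r))%N.
pose S := (\sum_(j <- J) d j)%N.
(* The summands ensure in turn that the trial comes late enough, that the primitive places are few,
   that the errors q (r + D) are at most n, that no revealed place is primitive, and that the window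
   stays positive. The modulus p^(q + r) exceeds 2 q, indeed any q + i with i <= r, as
   [logn_shift_bound] requires. *)
have [k kN kq] := expn_mod_cycle (q + r) (N0 + c + q * (r + D) + S + r).+1 p_pr q_pr pq.
have nk : (k < q ^ k)%N by exact: ltn_expl.
set n := (q ^ k)%N in kq nk.
have [N0k ck Dk Sk rk] := leq_sum_parts kN.
have rn : (r < n)%N by exact: leq_ltn_trans nk.
have k0 : (0 < k)%N by exact: leq_trans kN.
have n0 : (0 < n)%N by exact: leq_ltn_trans nk.
have Jd j : j \in J -> d j != n.
  move=> jJ; have : (d j <= S)%N by rewrite /S (big_rem j) //= leq_addr.
  by move=> h; rewrite ltn_eqF // (leq_ltn_trans h) // (leq_ltn_trans Sk).
have Wm m : m \in window n r -> [/\ (0 < m)%N, (m <= n + r)%N, ~~ (n %| m)%N &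
    (p ^ logn p m <= q + r)%N].
  move=> /(window_shift rn)[i /andP[i0 ir] mi].
  have /andP[m0 mr] := shift_bounds ir rn mi.
  split=> //.
  - apply/negP => nm; have : (n %| i)%N.
      case: mi => [mE|nE]; first by rewrite -(dvdn_addr _ (dvdnn n)) -mE.
      by rewrite -(dvdn_addr _ nm) -nE.
    by move/(dvdn_leq i0)/leq_trans/(_ ir); rewrite leqNgt rn.
  - have := logn_shift_bound p_pr (leq_ltn_trans ir rq) kq _ m0 mi.
    move=> h; apply: leq_trans (h _) _; last by rewrite leq_add2l.
    apply: leq_ltn_trans (ltn_expl (q + r) (prime_gt1 p_pr)).
    by rewrite leq_add2l.
pose Kmax := (K n + \sum_(m <- window n r) K m)%N.
have Kn : (K n <= Kmax)%N by exact: leq_addr.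
have Km m : m \in window n r -> (K m <= Kmax)%N.
  by move=> mw; rewrite /Kmax (big_rem m) //= addnCA leq_addr.
pose LA := primitive_places k.
(* The window events are averaged over [LB] alone: [J] is frozen, and the primitive places [LA] have
   weight zero for each m in the window. This lets the survival of [LA] factor out. *)
pose LB := [seq j <- iota 0 Kmax | (d j != n) && (j \notin J)].
have uLA : uniq LA by rewrite filter_uniq // iota_uniq.
have uLB : uniq LB by rewrite filter_uniq // iota_uniq.
have LALB j : j \in LB -> j \notin LA.
  by rewrite mem_filter mem_primitive_places => /andP[/andP[]].
have cover j : (j < Kmax)%N -> j \in J ++ (LA ++ LB).
  move=> jK; rewrite !mem_cat mem_primitive_places mem_filter mem_iota /= add0n jK.
  by rewrite andbT -/n; case: (d j == n); case: (j \in J).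
exists (k - N0)%N, (LA ++ LB); rewrite subnKC //.
split.
- by rewrite cat_uniq uLA uLB andbT /=; apply/hasPn => j /LALB.
- move=> j; rewrite mem_cat => /orP[|]; last by rewrite mem_filter => /andP[/andP[]].
  by rewrite mem_primitive_places => /eqP dj; apply: contraTN isT => /Jd; rewrite dj eqxx.
- move=> w w' ww; rewrite /peak; congr (_ && _).
    apply: eq_in_all => j jA; congr (~~ _); apply: ww.
    by rewrite !mem_cat jA orbT.
  apply: eq_in_all => m mw; rewrite (@surv_weight_depends m (J ++ (LA ++ LB)) _ w w') //.
  by move=> j jK; apply: cover; exact: leq_trans jK (Km _ mw).
move=> w; rewrite avg_cat.
pose PA (w : nat -> bool) := all (fun j => ~~ w j) LA.
pose F m (w : nat -> bool) : R := (q * surv_weight m w + 2 * n <= q * n)%N%:R.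
apply: le_trans (_ : avg rho LA (fun w => q%:R^-1 ^+ (2 * r).+1 * (PA w)%:R) w <= _).
  rewrite avgZ avg_all_false // /c' ler_pM2l ?exprn_gt0 ?invr_gt0 //.
  by apply: ler_wiXn2l; [exact: ltW|exact: ltW|apply: cP].
apply: (avg_le hrho) => w1.
have peakE w2 : (peak k w2)%:R = (PA w2)%:R * \prod_(m <- window n r) F m w2.
  rewrite /peak -mulnb natrM; congr (_ * _).
  elim: (window n r) => [|m s IH]; first by rewrite big_nil.
  by rewrite big_cons /= -mulnb natrM IH.
rewrite (avg_eq _ _ peakE) (@avg_indep_depends _ _ LA) //; first last.
  by move=> w2 w3 ww; apply: eq_in_all => j jA; rewrite ww.
rewrite mulrC ler_wpM2l //.
apply: le_trans (_ : q%:R^-1 ^+ size (window n r) <= _).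
  by apply: ler_wiXn2l; [rewrite invr_ge0 ltW|by []|exact: size_window].
apply: (avg_prod_ge hrho); [|by []|by rewrite invr_ge0 ltW|].
  by move=> m; exact: incr_window.
move=> m mw; have [m0 mn nm pm] := Wm m mw.
apply: (@avg_window_ge R rho hrho rhoq LB m w1 D k _ mn _ q2); last first.
  by apply: leq_trans Dk (ltnW nk).
apply: (@avg_surv_weight_le R rho hrho J LB m w1 D uLB m0).
  apply: (@leq_trans (\sum_(j <- J) deg j * (q + r))%N); last by rewrite /D /D0 big_distrl.
  rewrite -big_filter.
  apply: leq_trans (_ : \sum_(j <- [seq j <- index_iota 0 (K m) | j \in J]) deg j * (q + r) <= _)%N.
    apply: leq_sum => j _; apply: leq_trans (place_weight_logn p_pr hv j m0) _.
    by rewrite leq_mul2l pm orbT.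
  apply: (@uniq_sub_le_big _ addn leq leqnn (fun x y => leq_addr y x)) => //.
    by rewrite filter_uniq // iota_uniq.
  by move=> j; rewrite mem_filter => /andP[].
move=> j jK wj; rewrite mem_filter mem_iota /= add0n.
rewrite (leq_trans jK (Km _ mw)) andbT.
have [_ W _ _] := dP j; move: wj; rewrite W // => dm.
have -> : d j != n by apply: contraNneq nm => <-.
by case: (j \in J).
Qed.

End Peaks.

(** * Polynomial recurrences exclude peaks; conclusion *)

(** Bound e + 1 by (D + 1)(a + 1) with a the quotient of e by D + 1, and use a + 1 <= 2^a. The
    exponent is one more than the degree D to be beaten, which leaves a spare factor e + 1 against
    the constants. *)
Lemma expn_le_exp2 D e : (e.+1 ^ D.+1 <= D.+1 ^ D.+1 * 2 ^ e)%N.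
Proof.
apply: (@leq_trans (((e %/ D.+1).+1 * D.+1) ^ D.+1)%N).
  by rewrite leq_exp2r // ltn_ceil.
rewrite expnMn mulnC leq_mul2l; apply/orP; right.
apply: (@leq_trans ((2 ^ (e %/ D.+1)) ^ D.+1)%N).
  by rewrite leq_exp2r // ltn_expl.
by rewrite -expnM leq_exp2l // leq_divM.
Qed.

Section PolynomialGrowth.
Variable R : realType.
Implicit Types P : {poly R}.

Lemma poly_growth P x D : 0 <= x -> (size P <= D)%N ->
  `|P.[x]| <= (\sum_(i < size P) `|P`_i|) * (1 + x) ^+ D.
Proof.
move=> x0 PD; rewrite horner_coef (le_trans (ler_norm_sum _ _ _)) // mulr_suml.
apply: ler_sum => i _; rewrite normrM ler_wpM2l // normrX ger0_norm //.
apply: (@le_trans _ _ ((1 + x) ^+ i)); first by rewrite lerXn2r // ?nnegrE; lra.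
by rewrite ler_weXn2l //; [lra|rewrite (leq_trans _ PD) // ltnW].
Qed.

Lemma poly_ge_const P : P != 0 -> exists2 c : R, 0 < c &
  exists N, forall n, (N <= n)%N -> c <= `|P.[n%:R]|.
Proof.
elim/poly_ind: P => [|P a IH]; first by rewrite eqxx.
have [->|P0 _] := eqVneq P 0.
  rewrite mul0r add0r polyC_eq0 => a0; exists `|a|; first by rewrite normr_gt0.
  by exists 0%N => n _; rewrite hornerC.
have [c c0 [N NP]] := IH P0.
exists 1 => //; exists (maxn N (Num.truncn ((1 + `|a|) / c)).+1) => n.
rewrite geq_max => /andP[Nn an]; rewrite hornerMXaddC.
have h1 : 1 + `|a| <= c * n%:R.
  rewrite mulrC -ler_pdivrMr //; apply/ltW/(lt_le_trans (truncnS_gt _)).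
  by rewrite ler_nat.
have h2 : c * n%:R <= `|P.[n%:R] * n%:R|.
  by rewrite normrM (ger0_norm (ler0n R n)) ler_wpM2r // NP.
have := lerB_normD (P.[n%:R] * n%:R) a; lra.
Qed.

(** At a peak n = q e, every term but one is at most a n / p^e times a polynomial in e, while the
    coefficient of a n stays away from 0; this fails for large e. *)
Lemma no_recurrence (a : nat -> R) (b : nat -> nat) (p q s : nat) (c : nat -> {poly R}) :
  (1 < p)%N -> (0 < q)%N -> (forall n, (0 < n)%N -> a n = (p ^ b n)%:R) ->
  (exists2 j, (j <= s)%N & c j != 0) ->
  (forall N, (s <= N)%N -> \sum_(j < s.+1) (c j).[(N - j)%:R] * a (N - j)%N = 0) ->
  ~ (forall N, exists2 e, (N <= e)%N & forall m, m != (q * e)%N ->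
       (m <= q * e + s)%N -> (q * e <= m + s)%N -> (b m + e <= b (q * e))%N).
Proof.
move=> p1 q0 aE [j0 j0s cj0] rec peaks.
have [ep ep0 [N1 epP]] := poly_ge_const cj0.
pose D := (\sum_(j < s.+1) size (c j))%N.
pose A : R := \sum_(j < s.+1) \sum_(i < size (c j)) `|(c j)`_i|.
have A0 : 0 <= A by apply: sumr_ge0 => j _; apply: sumr_ge0.
have cP (j : 'I_s.+1) x : 0 <= x -> `|(c j).[x]| <= A * (1 + x) ^+ D.
  move=> x0; apply: le_trans (poly_growth (D := D) x0 _) _.
    by rewrite /D (bigD1 j) //= leq_addr.
  rewrite ler_wpM2r ?exprn_ge0 ?addr_ge0 // /A (bigD1 j) //= lerDl.
  by apply: sumr_ge0 => i _; apply: sumr_ge0.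
(* [B] gathers the number of terms, the size A of the coefficients and the factor in 1 + m <= (q + s
   + 1)(e + 1); [M] is the constant of [expn_le_exp2]. *)
pose B : R := s.+1%:R * (A * (q + s).+1%:R ^+ D).
pose M : R := (D.+1 ^ D.+1)%:R.
have [e eN pk] := peaks (N1 + s.+1 + (Num.truncn (M * B / ep)).+1)%N.
have e1 : (N1 <= e)%N by apply: leq_trans eN; rewrite -addnA leq_addr.
have es : (s < e)%N by apply: leq_trans eN; rewrite addnAC leq_addl.
have eM : M * B < ep * e.+1%:R.
  rewrite [ltRHS]mulrC -ltr_pdivrMr //.
  apply: (lt_le_trans (truncnS_gt _)); rewrite ler_nat leqW //.
  by apply: leq_trans eN; rewrite leq_addl.
set n := (q * e)%N in pk.
have en : (e <= n)%N by rewrite leq_pmull.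
have n0 : (0 < n)%N by apply: leq_trans en; apply: leq_ltn_trans es.
have an0 : 0 < a n by rewrite aE // ltr0n expn_gt0 ltnW.
have pe0 : 0 < (p ^ e)%:R :> R by rewrite ltr0n expn_gt0 ltnW.
have j0s' : (j0 < s.+1)%N by [].
have sn : (s <= n + j0)%N by rewrite ltnW // (leq_trans es) // (leq_trans en) // leq_addr.
(* The recurrence is taken at N = n + j0, so that its term with the nonzero coefficient [c j0] falls
   on the peak. *)
have := rec _ sn; rewrite (bigD1 (Ordinal j0s')) //= addnK => /eqP.
rewrite addr_eq0 => /eqP E.
have : ep * a n <= `|(c j0).[n%:R] * a n|.
  by rewrite normrM (gtr0_norm an0) (ler_wpM2r (ltW an0)) // epP // (leq_trans e1).
rewrite E normrN => H.
have term (j : 'I_s.+1) : j != Ordinal j0s' ->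
    `|(c j).[(n + j0 - j)%:R] * a (n + j0 - j)%N| <=
    A * (q + s).+1%:R ^+ D * e.+1%:R ^+ D * (a n / (p ^ e)%:R).
  move=> jj0; set m := (n + j0 - j)%N.
  have js : (j <= s)%N by rewrite -ltnS.
  have jn : (j < n)%N by rewrite (leq_ltn_trans js) // (leq_trans es).
  have m0 : (0 < m)%N by rewrite subn_gt0 (leq_trans jn) // leq_addr.
  have mn : m != n.
    apply: contra jj0 => /eqP; rewrite /m => h; apply/eqP/val_inj => /=; lia.
  have ms : (m <= n + s)%N by rewrite /m; lia.
  have nm : (n <= m + s)%N by rewrite /m; lia.
  rewrite normrM; apply: ler_pM => //.
    apply: le_trans (cP j _ (ler0n _ _)) _.
    rewrite -mulrA ler_wpM2l // -exprMn lerXn2r ?nnegrE ?addr_ge0 ?mulr_ge0 //.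
    rewrite -natrM -(natrD _ 1%N) ler_nat add1n.
    apply: (@leq_trans (n + s).+1); first by rewrite ltnS.
    by rewrite /n mulSn mulnDl mulnS; nia.
  rewrite ler_pdivlMr // ger0_norm ?(aE m) // (aE n) // -natrM ler_nat -expnD.
  by rewrite leq_exp2l // pk.
have {}H : ep * a n <= B * e.+1%:R ^+ D * (a n / (p ^ e)%:R).
  apply: le_trans H _; apply: le_trans (ler_norm_sum _ _ _) _.
  apply: le_trans (_ : \sum_(j < s.+1) A * (q + s).+1%:R ^+ D * e.+1%:R ^+ D * (a n / (p ^ e)%:R) <= _).
    rewrite big_mkcond; apply: ler_sum => j _; case: ifP => jj0; first exact: term.
    by rewrite !mulr_ge0 ?exprn_ge0 // ?invr_ge0 ltW.
  by rewrite sumr_const card_ord -[leLHS]mulr_natl /B !mulrA.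
have {H} : ep * (p ^ e)%:R <= B * e.+1%:R ^+ D.
  move: H; rewrite mulrCA [leRHS]mulrC ler_pM2r // ler_pdivlMr //.
have M2 : e.+1%:R ^+ D.+1 <= M * (p ^ e)%:R.
  rewrite -natrX -natrM ler_nat (leq_trans (expn_le_exp2 D e)) // leq_mul2l.
  by rewrite leq_exp2r ?p1 ?orbT // (leq_ltn_trans _ es).
have M0 : 0 < M by rewrite ltr0n expn_gt0.
have e0 : 0 < e.+1%:R ^+ D :> R by rewrite exprn_gt0.
move=> H; have : ep * e.+1%:R ^+ D.+1 <= M * (B * e.+1%:R ^+ D).
  apply: le_trans (_ : ep * (M * (p ^ e)%:R) <= _); first by rewrite ler_pM2l.
  by rewrite mulrCA ler_pM2l.
rewrite exprS mulrA [leRHS]mulrA ler_pM2r // => h.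
by move: eM; rewrite ltNge h.
Qed.

End PolynomialGrowth.

Lemma exists_prime_base (R : realType) (rho : R) (p r : nat) : rho < 1 -> exists q,
  [/\ prime q, odd q, p != q, (r < q)%N & (2 < q)%N /\ rho <= 1 - 4 / q%:R].
Proof.
move=> rho1; have [q qN q_pr] := prime_above (p + r + 2 + Num.truncn (4 / (1 - rho))).
have q2 : (2 < q)%N by apply: leq_ltn_trans qN; rewrite addnAC leq_addl.
exists q; split=> //.
- by case/even_prime: q_pr => // q2'; move: q2; rewrite q2'.
- rewrite neq_ltn; apply/orP; left; apply: leq_ltn_trans qN.
  by rewrite -!addnA leq_addr.
- by apply: leq_ltn_trans qN; rewrite -!addnA addnCA leq_addr.
split=> //; have q0 : 0 < q%:R :> R by rewrite ltr0n (ltn_trans _ q2).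
have : 4 / (1 - rho) < q%:R.
  apply: lt_le_trans (truncnS_gt _) _; rewrite ler_nat.
  by apply: leq_trans qN; rewrite ltnS leq_addl.
rewrite ltr_pdivrMr ?subr_gt0 // mulrC -ltr_pdivrMr // => h; lra.
Qed.

Lemma zeta_not_algebraic_ae (R : realType) (p : nat) (v : nat -> finite_place p)
    (rho : R) (mu : probability Omega R) :
  prime p -> place_enumeration v -> 0 < rho < 1 -> is_product_measure rho mu ->
  {ae mu, forall omega : Omega,
     ~ algebraic_function_on [set z : Cplx R | `|z| < p%:R^-1]
         (dynamical_zeta (@alpha_omega R p v omega))}.
Proof.
move=> p_pr hv hrho hmu; have [rho0 rho1] := andP hrho.
have p1 := prime_gt1 p_pr.
have [d dP] := place_orderP p_pr hv.
have supp n : exists K, (0 < n)%N -> forall k, (K <= k)%N -> place_weight v n k = 0%N.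
  have [->|n0] := posnP n; first by exists 0%N.
  by have [K KP] := place_weight_support p_pr hv n0; exists K.
have [K KP'] := choice supp.
have KP n k : (0 < n)%N -> (K n <= k)%N -> place_weight v n k = 0%N by move=> n0; exact: KP'.
have [q qP] := choice (fun r => @exists_prime_base R rho p r rho1).
pose bad r N : set Omega := [set w | forall t, ~~ peak v d K (q r) r (N + t) w].
have badN r N : mu.-negligible (bad r N).
  have [q_pr q_odd pq rq [q2 rhoq]] := qP r.
  exact: (negligible_no_peak p_pr hv dP KP q_pr q_odd pq rq N hrho hmu rhoq q2).
(* The length s of the recurrence is known only once the sample point is given, and infinitely many
   peaks are needed; hence the countable union over r and N. *)
have : mu.-negligible (\bigcup_r \bigcup_N bad r N).
  by apply: negligible_bigcup => r; apply: negligible_bigcup => N.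
apply: negligibleS => w /= /contrapT alg; apply: contrapT => nbad.
pose b n := surv_weight v K n w.
have cardE n : (0 < n)%N -> card_periodic (@alpha_omega R p v w) n = (p ^ b n)%N.
  by move=> n0; apply: card_periodic_weight => // k; exact: KP.
have bn n : (0 < n)%N -> (b n <= n)%N.
  by move=> n0; exact: sum_place_weight_le.
have card_le n : (card_periodic (@alpha_omega R p v w) n.+1 <= p ^ n.+1)%N.
  by rewrite cardE // leq_exp2l // bn.
have [P P0 evP] := algebraic_zeta_real (prime_gt0 p_pr) card_le alg.
(* The value at 0 is set to 0, as the series for log zeta starts at n = 1. *)
pose a n : R := if n == 0%N then 0 else (card_periodic (@alpha_omega R p v w) n)%:R.
have aE n : (0 < n)%N -> a n = (p ^ b n)%:R.
  by move=> n0; rewrite /a gtn_eqF // cardE.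
have aC : geom_le p%:R a.
  case=> [|n]; rewrite /a /=; first by rewrite normr0 exprn_ge0.
  rewrite normr_nat -natrX ler_nat (leq_trans (card_le n)) // leq_exp2l //.
have p1R : 1 <= p%:R :> R by rewrite ler1n prime_gt0.
have [s [c [c0 rec]]] := algebraic_recurrence (a := a) p1R aC erefl P0 evP.
have [q_pr q_odd pq sq [q2 rhoq]] := qP s.
have q0 := prime_gt0 q_pr.
apply: (no_recurrence p1 q0 aE c0 rec) => N.
have [t pk] : exists t, peak v d K (q s) s ((N + s).+1 + t) w.
  apply: contrapT => npk; apply: nbad; exists s => //; exists (N + s).+1 => //= t.
  by apply/negP => pk; apply: npk; exists t.
set k := ((N + s).+1 + t)%N in pk.
have Nsk : (N + s < k)%N by rewrite /k addSn ltnS leq_addr.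
have k0 : (0 < k)%N by exact: leq_trans Nsk.
have qE : (q s * q s ^ k.-1 = q s ^ k)%N by rewrite -expnS prednK.
have sk : (s < q s ^ k)%N.
  apply: leq_trans (ltnW (ltn_expl k (prime_gt1 q_pr))).
  by apply: leq_ltn_trans Nsk; rewrite leq_addl.
exists (q s ^ k.-1)%N.
  apply: leq_trans (ltnW (ltn_expl k.-1 (prime_gt1 q_pr))).
  by rewrite -ltnS prednK // (leq_ltn_trans _ Nsk) // leq_addr.
move=> m; rewrite qE => mn m1 m2.
have h := peakP p_pr hv dP KP q_pr q_odd pq sq k0 sk pk m1 m2 mn.
by rewrite -(leq_pmul2l q0) mulnDr qE.
Qed.

Theorem corollary7 (R : realType)
    (v : forall p : nat, nat -> finite_place p)
    (hv : forall p : nat, prime p -> place_enumeration (v p))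
    (rho : R) (hrho : 0 < rho < 1)
    (mu : probability Omega R) (hmu : is_product_measure rho mu) :
  exists E : seq nat,
    [/\ all prime E, (size E <= 2)%N &
      forall p : nat, prime p -> p \notin E ->
        {ae mu, forall omega : Omega,
          ~ algebraic_function_on [set z : Cplx R | `|z| < p%:R^-1]
              (dynamical_zeta (@alpha_omega R p (v p) omega))}].
Proof.
by exists [::]; split=> // p p_pr _; exact: zeta_not_algebraic_ae (hv p p_pr) hrho hmu.
Qed.
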